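(* Let $K=K_x\times K_y$ with $K_x\subset\mathbb{R}^n$, $K_y\subset\mathbb{R}^m$ closed convex sets, let $\varphi$ be $C^2$ and concave-convex on $K$, and let $\varphi$ have a $K$-restricted saddle point. Let $(\phi,K,d)$ denote the subgradient method on $K$ (applied to $\varphi$) and let $\Omega$ be its $\omega$-limit set. Then $\Omega$ is convex, and $(\phi,\Omega,d)$ defines a flow of isometries. Furthermore, the following hold: (i) The trajectories $\mathbf{z}(t)$ of $(\phi,\Omega,d)$ solve the ODE $$\dot{\mathbf{z}}=\mathbf{f}(\mathbf{z})-\mathbf{P}_{N_V}(\mathbf{f}(\mathbf{z})),\qquad \mathbf{f}=\begin{bmatrix}\varphi_x\\-\varphi_y\end{bmatrix},$$ where $V$ is the affine span of $F$, with $F$ being the minimal face of $K$ containing all $K$-restricted saddle points. (ii) If there exists a saddle point of $\varphi$ in the interior of $K$, then $$\Omega=\{\mathbf{z}(t)\in\mathcal{S}:\mathbf{z}(\mathbb{R})\subseteq K\},$$ where $\mathcal{S}$ is the set of solutions of the gradient method $\dot x=\varphi_x$, $\dot y=-\varphi_y$ (with no projection) that lie a constant distance from any saddle point of $\varphi$.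
   Context: $\varphi(x,y)$, $x\in\mathbb{R}^n$, $y\in\mathbb{R}^m$, is concave-convex if it is concave in $x$ for each fixed $y$ and convex in $y$ for each fixed $x$. A saddle point of $\varphi$ is a point $(\bar x,\bar y)$ with $\varphi(x,\bar y)\le\varphi(\bar x,\bar y)\le\varphi(\bar x,y)$ for all $x,y$ in the domain of definition. A $K$-restricted saddle point is a point $(\bar x,\bar y)\in K$ such that these inequalities hold for all $x\in\mathbb{R}^n$, $y\in\mathbb{R}^m$ with $(x,\bar y),(\bar x,y)\in K$. $d$ is the Euclidean metric. The normal cone is $N_K(\mathbf{z})=\{\mathbf{w}:\mathbf{w}^T(\mathbf{z}'-\mathbf{z})\le0\ \forall \mathbf{z}'\in K\}$ for $\mathbf{z}\in K$; for an affine subspace $V$ it does not depend on $\mathbf{z}\in V$ and is denoted $N_V$. $\mathbf{P}_C$ is Euclidean projection onto a non-empty closed convex set $C$. The subgradient method on a non-empty closed convex set $K\subseteq\mathbb{R}^{n+m}$, for $\varphi\in C^2$ concave-convex on $K$, is the semi-flow on $(K,d)$ consisting of Carathéodory solutions (absolutely continuous, satisfying the equation for almost all $t$) of $\dot{\mathbf{z}}=\mathbf{f}(\mathbf{z})-\mathbf{P}_{N_K(\mathbf{z})}(\mathbf{f}(\mathbf{z}))$ with $\mathbf{f}=(\varphi_x,-\varphi_y)$. A flow (resp. semi-flow) $(\phi,X,\rho)$ consists of a metric space $(X,\rho)$ and a continuous map $\phi:\mathbb{R}\times X\to X$ (resp. $\mathbb{R}_+\times X\to X$) with $\phi(0,x)=x$,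 $\phi(t+s,x)=\phi(t,\phi(s,x))$. Its $\omega$-limit set is $\bigcup_{x\in X}\bigcap_{t\ge0}\overline{\phi([t,\infty),x)}$. $(\phi,\Omega,d)$ is the restriction of $\phi$ to $\Omega$; it ''defines a flow of isometries'' if each $\phi(t,\cdot):\Omega\to\Omega$ is an invertible isometry (with $\phi(-t,\cdot):=\phi(t,\cdot)^{-1}$ on $\Omega$ for $t\geq 0$). A face of $K$ is a convex subset $F\subseteq K$ such that every line segment $L\subseteq K$ with $(\operatorname{relint}L)\cap F\neq\emptyset$ satisfies $L\subseteq F$. The minimal face containing $A\subseteq K$ is the intersection of all faces of $K$ containing $A$. In (ii), the sets $\Omega$ and $\mathcal S$ are described in terms of trajectories defined for all $t\in\mathbb{R}$: a trajectory is identified with the points it passes through, and ''constant distance from any saddle point'' means that the distance to each saddle point is constant in time. *)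

(* Defs.v *)
From HB Require Import structures.
From mathcomp Require Import all_boot all_order all_algebra.
From mathcomp Require Import all_classical all_reals all_analysis.
Import Order.TTheory GRing.Theory Num.Theory.
Import numFieldNormedType.Exports.

Set Implicit Arguments.
Unset Strict Implicit.
Unset Printing Implicit Defensive.

Local Open Scope classical_set_scope.
Local Open Scope ring_scope.

(* A point (x, y) of R^n x R^m is a row vector
   z : 'rV[R]_(n + m) with x = lsubmx z and y = rsubmx z.  The norm that the
   library puts on 'rV[R]_N is the sup norm; it is used only for its topology
   (the usual one), and the metric d of the statement is [edist]. *)

Section Euclidean.
Context {R : realType} {N : nat}.
Implicit Types (u v z w : 'rV[R]_N) (A C K F V : set 'rV[R]_N).

Definition dotp u v : R := \sum_(i < N) u ord0 i * v ord0 i.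

Definition edist u v : R := Num.sqrt (dotp (u - v) (u - v)).

(* The junk value 0 is never reached when C is non-empty, closed and convex. *)
Definition eproj C u : 'rV[R]_N :=
  xget 0 [set p | C p /\ forall q, C q -> edist u p <= edist u q].

Definition normal_cone K z : set 'rV[R]_N :=
  [set w | forall z', K z' -> dotp w (z' - z) <= 0].

(* For a non-empty affine V all the sets intersected here coincide. *)
Definition normal_cone_affine V : set 'rV[R]_N :=
  \bigcap_(z in V) normal_cone V z.

Definition affine_set V : Prop :=
  forall z w (t : R), V z -> V w -> V ((1 - t) *: z + t *: w).

Definition affine_span A : set 'rV[R]_N := smallest affine_set A.

Definition relint A : set 'rV[R]_N :=
  [set z | A z /\ \forall w \near z, affine_span A w -> A w].

Definition line_segment z w : set 'rV[R]_N :=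
  [set (1 - t) *: z + t *: w | t in `[0, 1]].

Definition is_face K F : Prop :=
  [/\ convex_set F, F `<=` K &
      forall z w, line_segment z w `<=` K ->
        relint (line_segment z w) `&` F !=set0 -> line_segment z w `<=` F].

Definition minimal_face K A : set 'rV[R]_N := smallest (is_face K) A.

Definition absolutely_continuous_on (a b : R) (u : R -> 'rV[R]_N) : Prop :=
  forall e : R, 0 < e -> exists2 d : R, 0 < d &
    forall (k : nat) (l r : 'I_k -> R),
      (forall i, [/\ a <= l i, l i <= r i & r i <= b]) ->
      trivIset [set: 'I_k] (fun i => `]l i, r i[%classic) ->
      \sum_(i < k) (r i - l i) < d ->
      \sum_(i < k) edist (u (r i)) (u (l i)) < e.

(* Solution on [0, +oo[ of the autonomous equation z' = g z. *)
Definition caratheodory_solution (g : 'rV[R]_N -> 'rV[R]_N)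
    (z : R -> 'rV[R]_N) : Prop :=
  (forall T : R, 0 <= T -> absolutely_continuous_on 0 T z) /\
  {ae @lebesgue_measure R, forall t : R, 0 <= t -> is_derive t 1 z (g (z t))}.

(* [Phi] is a (semi-)flow on X with set of times T: a flow for T = setT and a
   semi-flow for T = [0, +oo[; its values outside T x X are irrelevant. *)
Definition dynamical_system (T : set R) (X : set 'rV[R]_N)
    (Phi : R -> 'rV[R]_N -> 'rV[R]_N) : Prop :=
  [/\ forall t z, T t -> X z -> X (Phi t z),
      forall z, X z -> Phi 0 z = z,
      forall t s z, T t -> T s -> X z -> Phi (t + s) z = Phi t (Phi s z) &
      {within T `*` X, continuous (fun p : R * 'rV[R]_N => Phi p.1 p.2)}].

Definition semi_flow := dynamical_system [set t | 0 <= t].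
Definition flow := dynamical_system [set: R].

(* X is meant to be closed, so that the closure below can be taken in the
   ambient space. *)
Definition omega_limit (X : set 'rV[R]_N) (Phi : R -> 'rV[R]_N -> 'rV[R]_N) :
    set 'rV[R]_N :=
  \bigcup_(x in X) \bigcap_(t in [set t : R | 0 <= t])
    closure [set Phi s x | s in [set s : R | t <= s]].

Definition two_sided (X : set 'rV[R]_N) (Phi : R -> 'rV[R]_N -> 'rV[R]_N)
    (t : R) : 'rV[R]_N -> 'rV[R]_N :=
  if 0 <= t then Phi t else 'pinv_(fun=> 0) X (Phi (- t)).

Definition defines_flow_of_isometries (X : set 'rV[R]_N)
    (Phi : R -> 'rV[R]_N -> 'rV[R]_N) : Prop :=
  (forall t : R, 0 <= t ->
     set_bij X X (Phi t) /\
     forall z w, X z -> X w -> edist (Phi t z) (Phi t w) = edist z w) /\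
  flow X (two_sided X Phi).

(* C^2 in a neighbourhood of K; K itself may have empty interior. *)
Definition C2_on K (g : 'rV[R]_N -> R) : Prop :=
  exists U : set 'rV[R]_N, [/\ open U, K `<=` U &
    forall z, U z ->
      let e i : 'rV[R]_N := delta_mx ord0 i in
      [/\ {for z, continuous g},
          forall i, derivable g z (e i) /\ {for z, continuous ('D_(e i) g)} &
          forall i j, derivable ('D_(e i) g) z (e j) /\
                      {for z, continuous ('D_(e j) ('D_(e i) g))}]].

(* The set of full solutions of z' = g z at constant distance from each point
   of A. *)
Definition isometric_solutions (g : 'rV[R]_N -> 'rV[R]_N) A :
    set (R -> 'rV[R]_N) :=
  [set z | (forall t : R, is_derive t 1 z (g (z t))) /\
           (forall a, A a -> forall t s, edist (z t) a = edist (z s) a)].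

End Euclidean.

Section Saddle.
Context {R : realType} {n m : nat}.
Implicit Types (phi : 'rV[R]_n -> 'rV[R]_m -> R) (z : 'rV[R]_(n + m)).

Definition prod_set (A : set 'rV[R]_n) (B : set 'rV[R]_m) :
    set 'rV[R]_(n + m) :=
  [set z | A (lsubmx z) /\ B (rsubmx z)].

Definition concave_convex (A : set 'rV[R]_n) (B : set 'rV[R]_m) phi : Prop :=
  (forall y, B y -> convex_function A (fun x => - phi x y)) /\
  (forall x, A x -> convex_function B (fun y => phi x y)).

(* With D = K these are the K-restricted saddle points; with D the domain of
   definition of phi they are its saddle points. *)
Definition saddle_points (D : set 'rV[R]_(n + m)) phi : set 'rV[R]_(n + m) :=
  [set z | D z /\ forall x y,
     D (row_mx x (rsubmx z)) -> D (row_mx (lsubmx z) y) ->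
     phi x (rsubmx z) <= phi (lsubmx z) (rsubmx z) <= phi (lsubmx z) y].

Definition gradient {k : nat} (g : 'rV[R]_k -> R) (x : 'rV[R]_k) : 'rV[R]_k :=
  \row_i 'D_(delta_mx ord0 i) g x.

Definition saddle_field phi z : 'rV[R]_(n + m) :=
  row_mx (gradient (fun x => phi x (rsubmx z)) (lsubmx z))
         (- gradient (phi (lsubmx z)) (rsubmx z)).

Definition subgradient_method (K : set 'rV[R]_(n + m)) phi
    (Phi : R -> 'rV[R]_(n + m) -> 'rV[R]_(n + m)) : Prop :=
  semi_flow K Phi /\
  forall z0, K z0 ->
    caratheodory_solution
      (fun z => saddle_field phi z
                - eproj (normal_cone K z) (saddle_field phi z))
      (fun t => Phi t z0).

End Saddle.

(* Main.v *)
(** For f = (phi_x, - phi_y) with phi concave-convex, - f is monotone, and so is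
    the normal cone of K; hence the subgradient method contracts distances, and
    its fixed points are exactly the K-restricted saddle points.

    For a nonexpansive semi-flow with a fixed point the omega-limit set Omega
    consists of the recurrent points.  Two recurrent points are simultaneously
    recurrent, so their distance is constant along the semi-flow: the flow is
    isometric on Omega, and the rigidity of Euclidean segments makes Omega convex
    and the flow affine on it.

    On Omega the distance to every saddle point is constant, which forces the
    normal component n of the velocity to be orthogonal to e - z for every saddle
    point e.  The set of w in K with n . (w - z) = 0 is then a face of K
    containing all saddle points, so n lies in N_V.  Conversely the velocity is
    orthogonal to N_V because Omega is contained in the closure of the minimal
    face F: the projection of a fixed point onto a closed convex invariant set is
    a fixed point, and this produces, for each z in Omega, a saddle point in the
    relative interior of a segment of K with an end point arbitrarily close to z.
    So n is the projection of f on N_V for almost every time, and for every time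
    by continuity. *)
Require Import Defs.
From HB Require Import structures.
From mathcomp Require Import all_boot all_order all_algebra.
From mathcomp Require Import all_classical all_reals all_analysis.
From mathcomp Require Import ring lra.
Import Order.TTheory GRing.Theory Num.Theory.
Import numFieldNormedType.Exports.

Local Open Scope classical_set_scope.
Local Open Scope ring_scope.

Set Implicit Arguments.
Unset Strict Implicit.
Unset Printing Implicit Defensive.

(* The library also has an [edist], unrelated to the Euclidean one. *)
Local Notation edist := Defs.edist.

(** * Euclidean geometry *)

(* [ler_addgt0Pr] gives [e] a join structure as its type, which [lra] rejects. *)
Lemma ler_eps (R : realType) (x y : R) : (forall e : R, 0 < e -> x <= y + e) -> x <= y.
Proof. by move=> xy; apply/ler_addgt0Pr. Qed.

Section EuclideanGeometry.
Context {R : realType} {N : nat}.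
Implicit Types (u v w z p q : 'rV[R]_N) (C : set 'rV[R]_N).

Lemma dotpC u v : dotp u v = dotp v u.
Proof. by apply: eq_bigr => i _; rewrite mulrC. Qed.

Lemma dotpDl u v w : dotp (u + v) w = dotp u w + dotp v w.
Proof. by rewrite -big_split; apply: eq_bigr => i _; rewrite mxE mulrDl. Qed.

Lemma dotpZl (a : R) u v : dotp (a *: u) v = a * dotp u v.
Proof. by rewrite [RHS]mulr_sumr; apply: eq_bigr => i _; rewrite mxE mulrA. Qed.

Lemma dotpNl u v : dotp (- u) v = - dotp u v.
Proof. by rewrite -scaleN1r dotpZl mulN1r. Qed.

Lemma dotpBl u v w : dotp (u - v) w = dotp u w - dotp v w.
Proof. by rewrite dotpDl dotpNl. Qed.

Lemma dotpDr u v w : dotp u (v + w) = dotp u v + dotp u w.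
Proof. by rewrite dotpC dotpDl !(dotpC u). Qed.

Lemma dotpZr (a : R) u v : dotp u (a *: v) = a * dotp u v.
Proof. by rewrite dotpC dotpZl (dotpC u). Qed.

Lemma dotpNr u v : dotp u (- v) = - dotp u v.
Proof. by rewrite dotpC dotpNl (dotpC u). Qed.

Lemma dotpBr u v w : dotp u (v - w) = dotp u v - dotp u w.
Proof. by rewrite dotpDr dotpNr. Qed.

Lemma dotp0r u : dotp u 0 = 0.
Proof. by rewrite -(scale0r (0 : 'rV[R]_N)) dotpZr mul0r. Qed.

Lemma dotp0l u : dotp 0 u = 0.
Proof. by rewrite dotpC dotp0r. Qed.

Definition dotpE := (dotpDl, dotpDr, dotpNl, dotpNr, dotpZl, dotpZr).

Lemma dotp_ge0 u : 0 <= dotp u u.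
Proof. by apply: sumr_ge0 => i _; rewrite -expr2 sqr_ge0. Qed.

Lemma sqr_coord_le_dotp u i : u ord0 i ^+ 2 <= dotp u u.
Proof.
rewrite /dotp (bigD1 i) //= -expr2 lerDl.
by apply: sumr_ge0 => j _; rewrite -expr2 sqr_ge0.
Qed.

Lemma dotp_eq0 u : dotp u u = 0 -> u = 0.
Proof.
move=> u0; apply/rowP => i; rewrite mxE.
by apply/eqP; rewrite -sqrf_eq0 eq_le sqr_ge0 andbT -u0 sqr_coord_le_dotp.
Qed.

Lemma cauchy_schwarz_sqr u v : dotp u v ^+ 2 <= dotp u u * dotp v v.
Proof.
have := dotp_ge0 v; rewrite le_eqVlt => /orP[/eqP/esym v0|v_gt0].
  by rewrite (dotp_eq0 v0) !dotp0r mulr0 expr0n.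
have := dotp_ge0 (dotp v v *: u - dotp u v *: v).
rewrite !dotpE (dotpC v u) => h.
have {h} : 0 <= dotp v v * (dotp u u * dotp v v - dotp u v ^+ 2).
  by apply: le_trans h _; rewrite le_eqVlt; apply/orP; left; apply/eqP; ring.
by rewrite pmulr_rge0 // subr_ge0.
Qed.

Definition enorm u : R := Num.sqrt (dotp u u).

Lemma enorm_ge0 u : 0 <= enorm u. Proof. exact: sqrtr_ge0. Qed.

Lemma enorm_sqr u : enorm u ^+ 2 = dotp u u.
Proof. exact/sqr_sqrtr/dotp_ge0. Qed.

Lemma enorm0 : enorm 0 = 0.
Proof. by rewrite /enorm dotp0r sqrtr0. Qed.

Lemma enorm_eq0 u : enorm u = 0 -> u = 0.
Proof. by move=> u0; apply: dotp_eq0; rewrite -enorm_sqr u0 expr0n. Qed.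

Lemma enormN u : enorm (- u) = enorm u.
Proof. by rewrite /enorm dotpNl dotpNr opprK. Qed.

Lemma enormZ (a : R) u : enorm (a *: u) = `|a| * enorm u.
Proof.
by rewrite /enorm dotpZl dotpZr mulrA -expr2 sqrtrM ?sqr_ge0// sqrtr_sqr.
Qed.

Lemma ler_dotp_enorm u v : `|dotp u v| <= enorm u * enorm v.
Proof.
by rewrite -sqrtr_sqr /enorm -sqrtrM ?dotp_ge0// ler_wsqrtr// cauchy_schwarz_sqr.
Qed.

Lemma enormD u v : enorm (u + v) <= enorm u + enorm v.
Proof.
rewrite -(@ler_pXn2r _ 2)// ?nnegrE ?addr_ge0 ?enorm_ge0//.
have := le_trans (ler_norm _) (ler_dotp_enorm u v).
rewrite sqrrD !enorm_sqr !dotpE (dotpC v u); lra.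
Qed.

Lemma edistE u v : edist u v = enorm (u - v). Proof. by []. Qed.

Lemma edist_sqr u v : edist u v ^+ 2 = dotp (u - v) (u - v).
Proof. exact: enorm_sqr. Qed.

Lemma edist_ge0 u v : 0 <= edist u v. Proof. exact: enorm_ge0. Qed.

Lemma edistxx u : edist u u = 0. Proof. by rewrite edistE subrr enorm0. Qed.

Lemma edistC u v : edist u v = edist v u.
Proof. by rewrite !edistE -enormN opprB. Qed.

Lemma edist_triangle v u w : edist u w <= edist u v + edist v w.
Proof. by rewrite !edistE -[u - w](subrKA v) enormD. Qed.

Lemma edist_eq0 u v : edist u v = 0 -> u = v.
Proof. by move/enorm_eq0/subr0_eq. Qed.

Lemma edist_small_eq u v : (forall e : R, 0 < e -> edist u v <= e) -> u = v.
Proof.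
move=> uv; apply: edist_eq0; apply/eqP; rewrite eq_le edist_ge0 andbT.
by apply: ler_eps => e e0; rewrite add0r uv.
Qed.

Lemma coord_le_enorm u i : `|u ord0 i| <= enorm u.
Proof. by rewrite -sqrtr_sqr ler_wsqrtr// sqr_coord_le_dotp. Qed.

Lemma coord_le_edist u v i : `|u ord0 i - v ord0 i| <= edist u v.
Proof. by have := coord_le_enorm (u - v) i; rewrite !mxE. Qed.

Lemma mx_norm_le_enorm u : `|u| <= enorm u.
Proof.
rewrite /Num.Def.normr/= mx_normrE (bigmax_le _ (enorm_ge0 u))//= => -[i j] _ /=.
by rewrite ord1 coord_le_enorm.
Qed.

Lemma coord_le_mx_norm u i : `|u ord0 i| <= `|u|.
Proof.
rewrite [leRHS]/Num.Def.normr/= mx_normrE.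
exact: (le_bigmax _ (fun ij => `|u ij.1 ij.2|) (ord0, i)).
Qed.

Lemma enorm_le_sum u : enorm u <= \sum_i `|u ord0 i|.
Proof.
have ge0 (J : seq 'I_N) : 0 <= \sum_(i <- J) `|u ord0 i| by exact: sumr_ge0.
rewrite -(@ler_pXn2r _ 2)// ?nnegrE ?enorm_ge0// enorm_sqr /dotp.
elim: (index_enum _) => [|i J IH]; first by rewrite !big_nil expr0n.
rewrite !big_cons sqrrD -expr2 -(real_normK (num_real (u ord0 i))).
have := mulr_ge0 (normr_ge0 (u ord0 i)) (ge0 J); lra.
Qed.

Lemma enorm_le_mx_norm u : enorm u <= N%:R * `|u|.
Proof.
apply: (le_trans (enorm_le_sum u)).
have -> : N%:R * `|u| = \sum_(i < N) `|u|.
  by rewrite sumr_const card_ord mulr_natl.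
by apply: ler_sum => i _; exact: coord_le_mx_norm.
Qed.

(** The sup norm and the Euclidean norm bound each other up to the factor [N], so Euclidean balls
    generate the same topology. *)
Lemma nbhs_edistP z (A : set 'rV[R]_N) :
  nbhs z A <-> exists2 e : R, 0 < e & forall w, edist w z < e -> A w.
Proof.
split=> [/nbhs_ballP[e /= e0 eA]|[e e0 eA]].
  exists e => // w wz; apply: eA; rewrite -ball_normE /= distrC.
  exact: le_lt_trans (mx_norm_le_enorm _) wz.
(* Dividing by [N.+1] instead of [N] also covers dimension 0. *)
apply/nbhs_ballP; exists (e / N.+1%:R); first by rewrite /= divr_gt0.
move=> w; rewrite -ball_normE /= distrC => wz; apply: eA.
apply: le_lt_trans (enorm_le_mx_norm _) _.
have [N0|N0] := posnP N; first by rewrite [in N%:R]N0 mul0r.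
apply: le_lt_trans (_ : N.+1%:R * `|w - z| < _).
  by rewrite ler_wpM2r// ler_nat.
by rewrite mulrC -ltr_pdivlMr.
Qed.

Lemma closed_edistP (A : set 'rV[R]_N) z :
  closure A z <-> forall e : R, 0 < e -> exists2 w, A w & edist w z < e.
Proof.
split=> [cA e e0|Az B /nbhs_edistP[e e0 eB]].
  have /cA[w [Aw wz]] : nbhs z [set w | edist w z < e].
    by apply/nbhs_edistP; exists e.
  by exists w.
by have [w Aw wz] := Az e e0; exists w; split=> //; exact: eB.
Qed.

Definition eclosed C :=
  forall z, (forall e : R, 0 < e -> exists2 w, C w & edist w z < e) -> C z.

Lemma closed_eclosed C : closed C -> eclosed C.
Proof. by move=> cC z Cz; apply: cC; apply/closed_edistP. Qed.

(** Closed balls are compact. Arbitrarily late indices near [p] take the place of a convergent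
    subsequence. *)
Lemma bolzano_weierstrass (x : nat -> 'rV[R]_N) c (M : R) :
  (forall n, edist (x n) c <= M) ->
  exists p, forall e : R, 0 < e -> forall n, exists2 k, (n <= k)%N & edist (x k) p < e.
Proof.
move=> xM; pose A := [set v : 'rV[R]_N | edist v c <= M].
have cA : closed A.
  move=> z /closed_edistP zA; apply: ler_eps => e e0.
  have [w wA wz] := zA e e0.
  by apply: le_trans (edist_triangle w z c) _; rewrite edistC addrC lerD// ltW.
have bA : bounded_set A.
  exists (M + `|c|); split; first exact: num_real.
  move=> y yM v vA; apply: ltW; apply: le_lt_trans yM.
  rewrite -[v](subrK c); apply: le_trans (ler_normD _ _) _; rewrite lerD2r.
  exact: le_trans (mx_norm_le_enorm _) vA.
have cptA : compact A by exact: bounded_closed_compact.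
have [|p [_ clp]] := cptA (x @ \oo) _.
  by exists 0%N => // k _ /=; exact: xM.
exists p => e e0 n.
have xn : (x @ \oo) [set x k | k in [set k | (n <= k)%N]].
  by exists n => // k nk; exists k.
have np : nbhs p [set w | edist w p < e] by apply/nbhs_edistP; exists e.
by have [w [/= [k nk <-] kp]] := clp _ _ xn np; exists k.
Qed.

End EuclideanGeometry.

(** * Projection onto closed convex sets *)

Section Projection.
Context {R : realType} {N : nat}.
Implicit Types (u v w z p q : 'rV[R]_N) (C : set 'rV[R]_N).

Definition cvx C := forall (t : R) p q,
  0 <= t -> t <= 1 -> C p -> C q -> C (t *: p + (1 - t) *: q).

Lemma convex_set_cvx C : convex_set C <-> cvx C.
Proof.
split=> [cC t p q t0 t1 /mem_set Cp /mem_set Cq|cC p q t /set_mem Cp /set_mem Cq].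
  exact: set_mem (cC p q (Itv01 t0 t1) Cp Cq).
by apply/mem_set; apply: cC.
Qed.

Lemma eproj_min C u : eclosed C -> C !=set0 ->
  C (eproj C u) /\ forall q, C q -> edist u (eproj C u) <= edist u q.
Proof.
move=> cC [c Cc].
pose A := [set edist u q | q in C].
have hA : has_inf A.
  split; first by exists (edist u c); exists c.
  exists 0 => _ [q _ <-]. exact: edist_ge0.
(* A minimizing sequence; closedness puts its cluster point in [C], where the infimum is
   attained. *)
have /choice[x xP] n : exists q, C q /\ edist u q < inf A + n.+1%:R^-1.
  have [_ [q Cq <-] qn] := @inf_adherent _ A n.+1%:R^-1 ltac:(by []) hA.
  by exists q.
have xM n : edist (x n) u <= inf A + 1.
  rewrite edistC (le_trans (ltW (xP n).2))// lerD2l invf_le1//.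
  by rewrite ler1n.
have [p pP] := bolzano_weierstrass xM.
suff : [set p | C p /\ forall q, C q -> edist u p <= edist u q] p.
  exact: (xgetI 0).
split.
  apply: cC => e e0; have [k _ kp] := pP e e0 0%N.
  by exists (x k) => //; have [] := xP k.
move=> q Cq; apply: le_trans (_ : inf A <= _); last first.
  by apply: ge_inf; [exact: hA.2|exists q].
apply: ler_eps => /= e e0.
have e2 : 0 < e / 2 by rewrite divr_gt0.
have [n _ nP] := near_infty_natSinv_lt (PosNum e2).
have [k nk kp] := pP _ e2 n.
have := nP _ nk => /= kn.
apply: le_trans (edist_triangle (x k) _ _) _.
apply: le_trans (lerD (ltW (xP k).2) (ltW kp)) _.
by rewrite -addrA lerD2l [leRHS]splitr lerD2r ltW.
Qed.

(** First-order condition: the hypothesis expands to [2 * dotp u v <= t * dotp v v] for [t] in ]0,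
    1], which fails for a small [t] if [dotp u v] is positive. *)
Lemma dotp_le0_of_min u v :
  (forall t : R, 0 <= t -> t <= 1 -> dotp u u <= dotp (u - t *: v) (u - t *: v)) ->
  dotp u v <= 0.
Proof.
move=> uv; rewrite leNgt; apply/negP => a0.
have b0 := dotp_ge0 v.
have ab0 : 0 < dotp u v + dotp v v by rewrite ltr_wpDr.
(* The summand [dotp u v] in the denominator ensures [t <= 1], while [t * dotp v v] is at most
   [dotp u v]. *)
set t := dotp u v / (dotp u v + dotp v v).
have t0 : 0 < t by rewrite divr_gt0.
have t1 : t <= 1 by rewrite ler_pdivrMr// mul1r lerDl.
have := uv _ (ltW t0) t1; rewrite !dotpE (dotpC v u) => h.
have {h} : t * (2 * dotp u v) <= t * (t * dotp v v) by lra.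
rewrite ler_pM2l// /t mulrAC ler_pdivlMr// -subr_le0.
have -> : 2 * dotp u v * (dotp u v + dotp v v) - dotp u v * dotp v v =
  dotp u v * (2 * dotp u v + dotp v v) by ring.
by rewrite leNgt mulr_gt0// ltr_wpDr// mulr_gt0.
Qed.

(** Variational inequality of the projection: the segment from the projection to [q] stays in [C],
    and its start is the point nearest to [u]. *)
Lemma eprojP C u : eclosed C -> C !=set0 -> cvx C ->
  C (eproj C u) /\ forall q, C q -> dotp (u - eproj C u) (q - eproj C u) <= 0.
Proof.
move=> cC C0 vC; have [Cp pmin] := eproj_min u cC C0.
split=> // q Cq; set p := eproj C u in Cp pmin *.
apply: dotp_le0_of_min => t t0 t1.
have := pmin _ (vC t q p t0 t1 Cq Cp).
rewrite -(@ler_pXn2r _ 2)// ?nnegrE ?edist_ge0// !edist_sqr.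
suff -> : u - (t *: q + (1 - t) *: p) = (u - p) - t *: (q - p) by [].
by apply/rowP => i; rewrite !mxE; ring.
Qed.

(** Adding the variational inequalities of [p] and of the projection makes their squared distance
    nonpositive. *)
Lemma eproj_unique C u p : eclosed C -> cvx C -> C p ->
  (forall q, C q -> dotp (u - p) (q - p) <= 0) -> eproj C u = p.
Proof.
move=> cC vC Cp pP.
have [Cr rP] := eprojP u cC (ex_intro _ p Cp) vC.
have := rP _ Cp; have := pP _ Cr; set r := eproj C u => h1 h2.
apply/esym/subr0_eq/dotp_eq0/eqP; rewrite eq_le dotp_ge0 andbT.
have -> : dotp (p - r) (p - r) = dotp (u - r) (p - r) + dotp (u - p) (r - p).
  rewrite -[r - p]opprB dotpNr -dotpBl; congr dotp.
  by apply/rowP => i; rewrite !mxE; ring.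
lra.
Qed.

(** For the projections [p] and [q], the two variational inequalities give
    [edist p q ^+ 2 <= dotp (u - v) (p - q)]; Cauchy-Schwarz finishes. *)
Lemma eproj_nonexpansive C u v : eclosed C -> C !=set0 -> cvx C ->
  edist (eproj C u) (eproj C v) <= edist u v.
Proof.
move=> cC C0 vC.
have [Cp pP] := eprojP u cC C0 vC; have [Cq qP] := eprojP v cC C0 vC.
set p := eproj C u in Cp pP *; set q := eproj C v in Cq qP *.
have := pP _ Cq; have := qP _ Cp => h1 h2.
have h : edist p q ^+ 2 <= dotp (u - v) (p - q).
  rewrite edist_sqr -subr_ge0 -dotpBl.
  have -> : u - v - (p - q) = (u - p) - (v - q).
    by apply/rowP => i; rewrite !mxE; ring.
  by rewrite dotpBl subr_ge0 (le_trans h1)// -oppr_le0 -dotpNr opprB.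
have [p0|p0] := eqVneq (edist p q) 0; first by rewrite p0 edist_ge0.
have pq0 : 0 < edist p q by rewrite lt_neqAle eq_sym p0 edist_ge0.
rewrite -(ler_pM2r pq0) -expr2 (le_trans h)//.
exact: le_trans (ler_norm _) (ler_dotp_enorm _ _).
Qed.

End Projection.

(** * Nonexpansive semi-flows *)

Section Barycenter.
Context {R : realType} {N : nat}.
Implicit Types (p q x y w : 'rV[R]_N) (t : R).

(** Stewart's identity: the distances to [p] and [q] determine the distance to each point between
    them. *)
Lemma edist_barycenter_sqr t p q x :
  edist x (t *: p + (1 - t) *: q) ^+ 2 =
  t * edist x p ^+ 2 + (1 - t) * edist x q ^+ 2 - t * (1 - t) * edist p q ^+ 2.
Proof.
rewrite !edist_sqr.
have -> : x - (t *: p + (1 - t) *: q) = t *: (x - p) + (1 - t) *: (x - q).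
  by apply/rowP => i; rewrite !mxE; ring.
have -> : p - q = (x - q) - (x - p) by apply/rowP => i; rewrite !mxE; ring.
rewrite !dotpE (dotpC p x) (dotpC q x) (dotpC q p); ring.
Qed.

Lemma edist_barycenterl t p q : 0 <= t -> t <= 1 ->
  edist (t *: p + (1 - t) *: q) p = (1 - t) * edist p q.
Proof.
move=> t0 t1; rewrite edistC !edistE.
have -> : p - (t *: p + (1 - t) *: q) = (1 - t) *: (p - q).
  by apply/rowP => i; rewrite !mxE; ring.
by rewrite enormZ ger0_norm// subr_ge0.
Qed.

Lemma edist_barycenterr t p q : 0 <= t -> t <= 1 ->
  edist (t *: p + (1 - t) *: q) q = t * edist p q.
Proof.
move=> t0 t1; rewrite !edistE.
have -> : t *: p + (1 - t) *: q - q = t *: (p - q).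
  by apply/rowP => i; rewrite !mxE; ring.
by rewrite enormZ ger0_norm.
Qed.

(* Equality case of the triangle inequality in a strictly convex norm. *)
Lemma barycenter_rigid t p q x : 0 <= t -> t <= 1 ->
  edist x p <= (1 - t) * edist p q -> edist x q <= t * edist p q ->
  x = t *: p + (1 - t) *: q.
Proof.
move=> t0 t1 xp xq; apply: edist_eq0.
have t1' : 0 <= 1 - t by rewrite subr_ge0.
have sq (a b : R) : 0 <= a -> a <= b -> a ^+ 2 <= b ^+ 2.
  by move=> a0 ab; rewrite ler_pXn2r// nnegrE// (le_trans a0).
have /(ler_wpM2l t0) h1 := sq _ _ (edist_ge0 x p) xp.
have /(ler_wpM2l t1') h2 := sq _ _ (edist_ge0 x q) xq.
apply/eqP; rewrite -sqrf_eq0 eq_le sqr_ge0 andbT edist_barycenter_sqr.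
rewrite subr_le0; apply: le_trans (lerD h1 h2) _.
by rewrite le_eqVlt; apply/orP; left; apply/eqP; ring.
Qed.

Lemma edist_barycenter_le t p q p' q' : 0 <= t -> t <= 1 ->
  edist (t *: p + (1 - t) *: q) (t *: p' + (1 - t) *: q') <=
  t * edist p p' + (1 - t) * edist q q'.
Proof.
move=> t0 t1; rewrite !edistE.
have -> : t *: p + (1 - t) *: q - (t *: p' + (1 - t) *: q') =
    t *: (p - p') + (1 - t) *: (q - q').
  by apply/rowP => i; rewrite !mxE; ring.
apply: le_trans (enormD _ _) _.
by rewrite !enormZ !ger0_norm// subr_ge0.
Qed.

(** Total boundedness: without a finite net, points of [A] could be chosen greedily at mutual
    distances above [e], and such a sequence has no cluster point. *)
Lemma finite_net (A : set 'rV[R]_N) c (M e : R) : 0 < e ->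
  (forall w, A w -> edist w c <= M) ->
  exists s : seq 'rV[R]_N,
    (forall v, v \in s -> A v) /\
    forall w, A w -> exists2 v, v \in s & edist v w <= e.
Proof.
move=> e0 AM; apply: contrapT => noNet.
have /choice[F FP] (s : seq 'rV[R]_N) : exists w, (forall v, v \in s -> A v) ->
    A w /\ forall v, v \in s -> e < edist v w.
  apply: contrapT => noW; apply: noNet; exists s.
  have sA : forall v, v \in s -> A v.
    (* If [s] has an element outside [A], the condition on the witness is vacuous and any point
       serves. *)
    apply: contrapT => sA; apply: noW; by exists 0 => /sA.
  split=> // w Aw; apply: contrapT => far; apply: noW; exists w => _; split=> // v vs.
  by rewrite ltNge; apply/negP => vw; apply: far; exists v.
pose S n := iter n (fun s => F s :: s) [::].
have SA n : forall v, v \in S n -> A v.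
  elim: n => [|n IH] v //=; rewrite in_cons => /orP[/eqP ->|]; last exact: IH.
  exact: (FP _ IH).1.
have FS m n : (m < n)%N -> F (S m) \in S n.
  elim: n => // n IH; rewrite ltnS leq_eqVlt => /orP[/eqP ->|/IH mn] /=.
    by rewrite mem_head.
  by rewrite in_cons mn orbT.
have xM n : edist (F (S n)) c <= M by apply: AM; exact: (FP _ (SA n)).1.
have [p pP] := bolzano_weierstrass xM.
have e2 : 0 < e / 2 by rewrite divr_gt0.
have [i _ ip] := pP _ e2 0%N; have [j ij jp] := pP _ e2 i.+1.
have := (FP _ (SA j)).2 _ (FS _ _ ij); rewrite ltNge => /negP; apply.
apply: le_trans (edist_triangle p _ _) _.
by rewrite (edistC p) [leRHS]splitr lerD// ltW.
Qed.

End Barycenter.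

(** What the theory of recurrence uses of the subgradient method. The fixed point [o] keeps all
    orbits bounded. *)
Record nonexpansive_semiflow (R : realType) (N : nat) (K : set 'rV[R]_N)
    (Phi : R -> 'rV[R]_N -> 'rV[R]_N) (o : 'rV[R]_N) : Prop := {
  nes_closed : eclosed K;
  nes_cvx : cvx K;
  nes_stable : forall (t : R) z, 0 <= t -> K z -> K (Phi t z);
  nes_0 : forall z, K z -> Phi 0 z = z;
  nes_D : forall (t s : R) z, 0 <= t -> 0 <= s -> K z ->
    Phi (t + s) z = Phi t (Phi s z);
  nes_nonexpansive : forall (t : R) z w, 0 <= t -> K z -> K w ->
    edist (Phi t z) (Phi t w) <= edist z w;
  nes_time_continuous : forall z (T d : R), K z -> 0 < d ->
    exists2 h : R, 0 < h & forall t s : R, 0 <= s -> s <= t -> t <= T ->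
      t - s < h -> edist (Phi t z) (Phi s z) < d;
  nes_fixed_in : K o;
  nes_fixed : forall t : R, 0 <= t -> Phi t o = o }.

(** * Recurrent points of a nonexpansive semi-flow *)

Section NonexpansiveSemiflow.
Context {R : realType} {N : nat} {K : set 'rV[R]_N}
  {Phi : R -> 'rV[R]_N -> 'rV[R]_N} {o : 'rV[R]_N}.
Context (H : nonexpansive_semiflow K Phi o).
Implicit Types (p q z w e : 'rV[R]_N) (t s T : R).

Let clK := nes_closed H.
Let vK := nes_cvx H.
Let PhiK := nes_stable H.
Let Phi0 := nes_0 H.
Let PhiD := nes_D H.
Let PhiL := nes_nonexpansive H.
Let Ko := nes_fixed_in H.
Let Phio := nes_fixed H.

Definition omega_point p q := forall d T : R, 0 < d -> 0 <= T ->
  exists2 s, T <= s & edist (Phi s p) q < d.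

Definition recurrent p := K p /\ omega_point p p.

Lemma PhiB t s z : 0 <= s -> s <= t -> K z -> Phi t z = Phi (t - s) (Phi s z).
Proof. by move=> s0 st Kz; rewrite -PhiD ?subr_ge0// subrK. Qed.

Lemma PhiC t s z : 0 <= t -> 0 <= s -> K z -> Phi t (Phi s z) = Phi s (Phi t z).
Proof. by move=> t0 s0 Kz; rewrite -!PhiD// addrC. Qed.

Lemma orbit_bounded t z : 0 <= t -> K z -> edist (Phi t z) o <= edist z o.
Proof. by move=> t0 Kz; rewrite -{1}(Phio t0) PhiL. Qed.

Lemma omega_pointK p q : K p -> omega_point p q -> K q.
Proof.
move=> Kp pq; apply: clK => d d0; have [s s0 sd] := pq d 0 d0 (lexx 0).
by exists (Phi s p) => //; exact: PhiK.
Qed.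

(** If the orbit of [p] is near [q] at time [s] and again at time [r], then by nonexpansiveness
    [Phi (r - s)] moves [q] only a little. *)
Lemma omega_point_recurrent p q : K p -> omega_point p q -> recurrent q.
Proof.
move=> Kp pq; have Kq := omega_pointK Kp pq; split=> // d T d0 T0.
have d2 : 0 < d / 2 by rewrite divr_gt0.
have [s s0 sd] := pq _ 0 d2 (lexx 0).
have [r sr rd] := pq _ _ d2 (addr_ge0 T0 s0).
have sr' : s <= r by rewrite (le_trans _ sr)// lerDr.
exists (r - s); first by rewrite lerBrDr.
apply: le_lt_trans (edist_triangle (Phi r p) _ _) _.
rewrite [ltRHS]splitr ler_ltD// (PhiB s0 sr')//.
by apply: le_trans (PhiL _ _ _) _; rewrite ?subr_ge0//; [exact: PhiK|rewrite edistC ltW].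
Qed.

(** A recurrent point is an omega-limit point of its own orbit, so the union over all starting
    points can be forgotten. *)
Lemma omega_limit_recurrent q : omega_limit K Phi q <-> recurrent q.
Proof.
split=> [[p Kp pq]|[Kq qq]].
  apply: (omega_point_recurrent Kp) => d T d0 T0.
  by have /closed_edistP/(_ d d0)[_ [s Ts <-]] := pq T T0; exists s.
exists q => // T T0; apply/closed_edistP => d d0.
by have [s Ts sq] := qq d T d0 T0; exists (Phi s q) => //; exists s.
Qed.

Lemma recurrent_eclosed : eclosed recurrent.
Proof.
move=> z zP.
have Kz : K z by apply: clK => d /zP[w [Kw _] wz]; exists w.
split=> // d T d0 T0; have d3 : 0 < d / 3 by rewrite divr_gt0.
have [w [Kw wR] wz] := zP _ d3; have [s Ts sw] := wR _ _ d3 T0.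
have s0 := le_trans T0 Ts.
exists s => //.
have h1 := PhiL s0 Kz Kw.
have h2 := edist_triangle (Phi s w) (Phi s z) z.
have h3 := edist_triangle w (Phi s w) z.
move: wz h1; rewrite (edistC z w); lra.
Qed.

Lemma recurrent_Phi t p : 0 <= t -> recurrent p -> recurrent (Phi t p).
Proof.
move=> t0 [Kp pR]; split; first exact: PhiK.
move=> d T d0 T0; have [s Ts sp] := pR d T d0 T0; exists s => //.
have s0 := le_trans T0 Ts.
by rewrite PhiC//; apply: le_lt_trans sp; apply: PhiL => //; exact: PhiK.
Qed.

(* The partial sums S of rapidly improving return times of p give return times
   S j - S i of p; two of the points Phi (S i) q being close, one of these
   differences is a return time of Phi (S i) q, hence of the recurrent q. *)
Lemma joint_recurrence p q : recurrent p -> recurrent q ->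
  forall d T, 0 < d -> 0 <= T ->
  exists s, [/\ T <= s, edist (Phi s p) p < d & edist (Phi s q) q < d].
Proof.
move=> [Kp pR] [Kq qR] d T d0 T0.
(* The estimate for [q] adds four errors below [c]. *)
pose c := d / 5.
have c0 : 0 < c by rewrite divr_gt0.
have g0 k : 0 < c * 2^-1 ^+ k :> R by rewrite mulr_gt0// exprn_gt0// invr_gt0.
have /choice[r rP] k : exists s, T <= s /\ edist (Phi s p) p < c * 2^-1 ^+ k.+1.
  by have [s Ts sp] := pR _ _ (g0 k.+1) T0; exists s.
have r0 k : 0 <= r k := le_trans T0 (rP k).1.
pose S n := \sum_(i < n) r i.
have S_S n : S n.+1 = S n + r n by rewrite /S big_ord_recr.
have S0 n : 0 <= S n by apply: sumr_ge0.
have Sle i k : S i <= S (i + k)%N.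
  by elim: k => [|k IH]; rewrite ?addn0// addnS S_S ler_wpDr.
(* By nonexpansiveness the errors of the single returns add up, and their geometric sum
   telescopes. *)
have Sp i k : edist (Phi (S (i + k)%N - S i) p) p <= c * (2^-1 ^+ i - 2^-1 ^+ (i + k)).
  elim: k => [|k IH]; first by rewrite addn0 !subrr mulr0 Phi0// edistxx.
  have b0 : 0 <= S (i + k)%N - S i by rewrite subr_ge0.
  rewrite addnS S_S addrAC addrC PhiD//.
  have h1 := PhiL (r0 (i + k)%N) (PhiK b0 Kp) Kp.
  have h2 := edist_triangle (Phi (r (i + k)%N) p) (Phi (r (i + k)%N) (Phi (S (i + k)%N - S i) p)) p.
  have := (rP (i + k)%N).2; move: IH h1 h2; rewrite exprS; lra.
have [z zP] := @bolzano_weierstrass _ _ (fun n => Phi (S n) q) o _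
                (fun n => orbit_bounded (S0 n) Kq).
(* Taking [j] beyond [i] leaves at least the summand [r i >= T] in [S j - S i]. *)
have [i _ iz] := zP _ c0 0%N; have [j ij jz] := zP _ c0 i.+1.
have [k kP] : exists k, j = (i + k.+1)%N.
  by exists (j - i.+1)%N; rewrite addnS -addSn subnKC.
pose s := S j - S i.
have Ts : T <= s.
  rewrite /s kP -addSnnS lerBrDr; apply: le_trans (Sle i.+1 k).
  by rewrite S_S addrC lerD2l (rP i).1.
have s0 : 0 <= s := le_trans T0 Ts.
exists s; split=> //.
  rewrite /s kP; apply: le_lt_trans (Sp _ _) _.
  have h1 := g0 (i + k.+1)%N.
  have : 2^-1 ^+ i <= 1 :> R by rewrite exprn_ile1// invf_le1// ler1n.
  rewrite -(ler_pM2l c0) mulrBr; move: h1 c0; rewrite /c; lra.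
(* A late return [Phi a q] lies on the orbit after [Phi (S i) q], so [Phi s] displaces it no more
   than it displaces [Phi (S i) q]. *)
have [a ia aq] := qR c (S i) c0 (S0 i).
have a0 : 0 <= a := le_trans (S0 i) ia.
have Kx := PhiK (S0 i) Kq.
have Ka := PhiK a0 Kq.
have h1 := PhiL s0 Kq Ka.
have h2 : edist (Phi s (Phi a q)) (Phi a q) <= edist (Phi (S j) q) (Phi (S i) q).
  have ai0 : 0 <= a - S i by rewrite subr_ge0.
  rewrite (PhiB (S0 i) ia Kq) (PhiC s0 ai0 Kx).
  have -> : Phi (S j) q = Phi s (Phi (S i) q).
    by rewrite (@PhiB (S j) (S i))// kP.
  by apply: PhiL => //; exact: PhiK.
have h3 := edist_triangle z (Phi (S j) q) (Phi (S i) q).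
have h4 := edist_triangle (Phi s (Phi a q)) (Phi s q) q.
have h5 := edist_triangle (Phi a q) (Phi s (Phi a q)) q.
move: iz h1 h3 aq; rewrite (edistC z) (edistC q); move: jz h2 h4 h5 d0; rewrite /c; lra.
Qed.

(** The distance never increases, and at a late joint return time it is almost back at its initial
    value. *)
Lemma recurrent_isometry t p q : 0 <= t -> recurrent p -> recurrent q ->
  edist (Phi t p) (Phi t q) = edist p q.
Proof.
move=> t0 Rp Rq; have [[Kp _] [Kq _]] := (Rp, Rq).
apply/eqP; rewrite eq_le PhiL//=.
apply: ler_eps => d d0; have d2 : 0 < d / 2 by rewrite divr_gt0.
have [s [ts sp sq]] := joint_recurrence Rp Rq d2 t0.
have h : edist (Phi s p) (Phi s q) <= edist (Phi t p) (Phi t q).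
  by rewrite !(PhiB t0 ts)//; apply: PhiL; rewrite ?subr_ge0//; exact: PhiK.
have h1 := edist_triangle (Phi s p) p q.
have h2 := edist_triangle (Phi s q) (Phi s p) q.
by move: h1; rewrite (edistC p (Phi s p)); lra.
Qed.

(** Distances to the images of [p] and [q] do not grow, and the distance between these images is
    preserved; rigidity of segments leaves a single point. *)
Lemma Phi_barycenter (a : R) t p q : 0 <= a -> a <= 1 -> 0 <= t ->
  recurrent p -> recurrent q ->
  Phi t (a *: p + (1 - a) *: q) = a *: Phi t p + (1 - a) *: Phi t q.
Proof.
move=> a0 a1 t0 Rp Rq; have [[Kp _] [Kq _]] := (Rp, Rq).
have Kc := vK a0 a1 Kp Kq.
apply: barycenter_rigid => //; rewrite (recurrent_isometry t0 Rp Rq).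
  by rewrite -(edist_barycenterl _ _ a0 a1) PhiL.
by rewrite -(edist_barycenterr _ _ a0 a1) PhiL.
Qed.

(** [Phi] is affine on the segment, so a joint return time of the end points is a return time of
    every point between them. *)
Lemma recurrent_cvx : cvx recurrent.
Proof.
move=> a p q a0 a1 Rp Rq; split; first by apply: vK => //; [exact: Rp.1|exact: Rq.1].
move=> d T d0 T0; have [s [Ts sp sq]] := joint_recurrence Rp Rq d0 T0.
exists s => //; rewrite Phi_barycenter// ?(le_trans T0)//.
apply: le_lt_trans (edist_barycenter_le _ _ _ _ a0 a1) _.
have [->|a0'] := eqVneq a 0; first by rewrite mul0r add0r subr0 mul1r.
have -> : d = a * d + (1 - a) * d by ring.
apply: ltr_leD; first by rewrite ltr_pM2l// lt_neqAle eq_sym a0'.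
by rewrite ler_wpM2l ?subr_ge0// ltW.
Qed.

(** If the orbit approaches [w] at the times [s n], a cluster point of the orbit at the times
    [s n - t] is an omega-limit point sent to [w] by [Phi t]. *)
Lemma omega_point_preimage t p w : 0 <= t -> K p -> omega_point p w ->
  exists2 w', omega_point p w' & Phi t w' = w.
Proof.
move=> t0 Kp pw.
have /choice[s sP] n : exists s, n%:R + t <= s /\ edist (Phi s p) w < n.+1%:R^-1.
  have [||s] := pw n.+1%:R^-1 (n%:R + t); rewrite ?invr_gt0 ?addr_ge0//.
  by exists s.
have st n : n%:R <= s n - t by rewrite lerBrDr (sP n).1.
have st0 n : 0 <= s n - t := le_trans (ler0n _ n) (st n).
have [q qP] := @bolzano_weierstrass _ _ (fun n => Phi (s n - t) p) o _
                (fun n => orbit_bounded (st0 n) Kp).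
have pq : omega_point p q.
  move=> d T d0 T0; have [k Tk kq] := qP d d0 (Num.truncn T).+1.
  exists (s k - t) => //; apply: le_trans (st k).
  apply/ltW/(lt_le_trans (truncnS_gt T)).
  by rewrite ler_nat.
exists q => //; apply: edist_small_eq => d d0.
have d2 : 0 < d / 2 by rewrite divr_gt0.
have [n _ nP] := near_infty_natSinv_lt (PosNum d2).
have [k nk kq] := qP _ d2 n.
have := nP _ nk => /= kd.
apply: le_trans (edist_triangle (Phi (s k) p) _ _) _.
rewrite [leRHS]splitr lerD//; last exact: ltW (lt_trans (sP k).2 kd).
have -> : Phi (s k) p = Phi t (Phi (s k - t) p).
  by rewrite -PhiD// addrC subrK.
apply: le_trans (PhiL t0 _ _) _; [exact: omega_pointK pq|exact: PhiK|].
by rewrite edistC ltW.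
Qed.

(** The fixed point is the projection of [o]: [Phi t] keeps it in [E] without increasing its
    distance to [o], and the nearest point is unique. *)
Lemma fixed_point_of_invariant (E : set 'rV[R]_N) :
  E `<=` K -> eclosed E -> cvx E -> E !=set0 ->
  (forall t z, 0 <= t -> E z -> E (Phi t z)) ->
  exists2 e, E e & forall t, 0 <= t -> Phi t e = e.
Proof.
move=> EK cE vE E0 EPhi; have [Ee eP] := eprojP o cE E0 vE.
exists (eproj E o) => //; move: (eproj E o) Ee eP => e Ee eP t t0.
apply/subr0_eq/dotp_eq0/eqP; rewrite eq_le dotp_ge0 andbT.
have h := eP _ (EPhi _ _ t0 Ee).
have : edist (Phi t e) o ^+ 2 <= edist e o ^+ 2.
  by rewrite ler_pXn2r ?nnegrE ?edist_ge0// orbit_bounded//; exact: EK.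
rewrite !edist_sqr.
have -> : Phi t e - o = (Phi t e - e) - (o - e).
  by apply/rowP => i; rewrite !mxE; ring.
rewrite -[e - o]opprB.
move: h; rewrite !dotpE (dotpC e o) (dotpC (Phi t e) o) (dotpC (Phi t e) e); lra.
Qed.

(** The surplus weight [a - b] of [p] is moved into the second point, which stays recurrent by
    convexity. *)
Lemma weight_decrease (a b : R) p c q : 0 < b -> b <= a -> a < 1 ->
  recurrent p -> recurrent q -> c = a *: p + (1 - a) *: q ->
  exists2 q', recurrent q' & c = b *: p + (1 - b) *: q'.
Proof.
move=> b0 ba a1 Rp Rq ->.
have b1 : 0 < 1 - b by rewrite subr_gt0 (le_lt_trans ba).
have bn0 := lt0r_neq0 b1.
exists (((a - b) / (1 - b)) *: p + (1 - (a - b) / (1 - b)) *: q).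
  apply: recurrent_cvx => //; first by rewrite divr_ge0 ?subr_ge0// ltW// (le_lt_trans ba).
  by rewrite ler_pdivrMr// mul1r lerD2r ltW.
by apply/rowP => i; rewrite !mxE; field.
Qed.

(** By induction, [c] is replaced by its midpoint with the next point, which halves the weight. The
    weight is common to all of [s], so that the representations in [fixed_barycenter] can be
    averaged. *)
Lemma common_barycenter (s : seq 'rV[R]_N) p : recurrent p ->
  (forall v, v \in s -> recurrent v) ->
  exists c a, [/\ recurrent c, 0 < a, a < 1 & forall v, v \in s ->
    exists2 q, recurrent q & c = a *: v + (1 - a) *: q].
Proof.
move=> Rp; elim: s => [_|w s IH sR].
  by exists p, 2^-1; split=> //; rewrite ?invr_gt0// invf_lt1// ltr1n.
have [|c [a [Rc a0 a1 cP]]] := IH.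
  by move=> v vs; apply: sR; rewrite in_cons vs orbT.
have Rw : recurrent w by apply: sR; rewrite mem_head.
have h0 : 0 <= 2^-1 :> R by rewrite invr_ge0.
have h1 : 2^-1 < 1 :> R by rewrite invf_lt1// ltr1n.
exists (2^-1 *: w + (1 - 2^-1) *: c), (a / 2); split.
- by apply: recurrent_cvx => //; exact: ltW.
- by rewrite divr_gt0.
- by lra.
move=> v; rewrite in_cons => /orP[/eqP ->|/cP[q Rq cq]].
  by apply: (weight_decrease _ _ h1 Rw Rc erefl); lra.
have b0 : 0 < 2 - a by lra.
(* Solves [(w + a v + (1 - a) q) / 2 = (a / 2) v + (1 - a / 2) q'] for [q']. *)
exists ((2 - a)^-1 *: w + (1 - (2 - a)^-1) *: q).
  apply: recurrent_cvx => //; first by rewrite invr_ge0 ltW.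
  by rewrite invf_le1//; lra.
rewrite cq; apply/rowP => i; rewrite !mxE; field; exact: lt0r_neq0.
Qed.

(* The set E of points c having, for every w in the omega-limit set of z, a
   representation c = a p + (1 - a) q with p close to w, is closed, convex and
   invariant, so it contains a fixed point. *)
Lemma fixed_barycenter z (d : R) : recurrent z -> 0 < d ->
  exists a p q e,
  [/\ [/\ 0 < a, a < 1 & e = a *: p + (1 - a) *: q],
      recurrent p, recurrent q, edist p z <= d &
      K e /\ forall t, 0 <= t -> Phi t e = e].
Proof.
move=> Rz d0; have [Kz zz] := Rz.
have wR w : omega_point z w -> recurrent w by exact: omega_point_recurrent.
(* A finite net of the omega-limit set of [z] lets one barycenter serve all its points up to an
   error [d]. *)
have [w wz|s [sz sP]] := @finite_net _ _ (omega_point z) o (edist z o) _ d0.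
  apply: ler_eps => e e0; have [t t0 tw] := wz e 0 e0 (lexx 0).
  apply: le_trans (edist_triangle (Phi t z) _ _) _.
  by rewrite addrC lerD ?orbit_bounded// edistC ltW.
have [|c [a [Rc a0 a1 cP]]] := common_barycenter (s := s) Rz.
  by move=> v /sz/wR.
have a0' := ltW a0; have a1' := ltW a1.
pose E := [set c | recurrent c /\ forall w, omega_point z w ->
  exists p q, [/\ recurrent p, recurrent q, edist p w <= d &
                  c = a *: p + (1 - a) *: q]].
have E0 : E !=set0.
  exists c; split=> // w /sP[v vs vw]; have [q Rq cq] := cP _ vs.
  by exists v, q; split=> //; exact/wR/sz.
have vE : cvx E.
  move=> t c1 c2 t0 t1 [R1 P1] [R2 P2]; split; first exact: recurrent_cvx.
  move=> w zw; have [p1 [q1 [Rp1 Rq1 pw1 ->]]] := P1 w zw.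
  have [p2 [q2 [Rp2 Rq2 pw2 ->]]] := P2 w zw.
  exists (t *: p1 + (1 - t) *: p2), (t *: q1 + (1 - t) *: q2); split.
  - exact: recurrent_cvx.
  - exact: recurrent_cvx.
  - have -> : w = t *: w + (1 - t) *: w.
      by apply/rowP => i; rewrite !mxE; ring.
    apply: le_trans (edist_barycenter_le _ _ _ _ t0 t1) _.
    have -> : d = t * d + (1 - t) * d by ring.
    by rewrite lerD// ler_wpM2l// subr_ge0.
  - by apply/rowP => i; rewrite !mxE; ring.
have EPhi t c' : 0 <= t -> E c' -> E (Phi t c').
  move=> t0 [Rc' Pc']; split; first exact: recurrent_Phi.
  (* Each omega-limit point of [z] is the image under [Phi t] of another one, whose representation
     is carried along. *)
  move=> w zw; have [w' zw' <-] := omega_point_preimage t0 Kz zw.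
  have [p [q [Rp Rq pw ->]]] := Pc' _ zw'.
  exists (Phi t p), (Phi t q); split; [exact: recurrent_Phi..| |exact: Phi_barycenter].
  by rewrite recurrent_isometry//; exact: wR.
have cE : eclosed E.
  move=> x xP; have Rx : recurrent x.
    by apply: recurrent_eclosed => e /xP[y [Ry _] yx]; exists y.
  split=> // w zw.
  have /choice[f fP] n : exists pq : 'rV[R]_N * 'rV[R]_N,
      [/\ recurrent pq.1, recurrent pq.2, edist pq.1 w <= d &
          edist (a *: pq.1 + (1 - a) *: pq.2) x < n.+1%:R^-1].
    have [|y [_ /(_ _ zw)[p [q [Rp Rq pw ->]]]] yx] := xP n.+1%:R^-1.
      by rewrite invr_gt0.
    by exists (p, q).
  have [|p pP] := @bolzano_weierstrass _ _ (fun n => (f n).1) w d.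
    by move=> n; have [] := fP n.
  have a1n : 0 < 1 - a by rewrite subr_gt0.
  (* Only the first points need a cluster point; the second point is then determined by [x] and the
     weight. *)
  exists p, ((1 - a)^-1 *: (x - a *: p)); split.
  - apply: recurrent_eclosed => e /pP/(_ 0%N)[k _ kp]; exists (f k).1 => //.
    by have [] := fP k.
  - apply: recurrent_eclosed => e e0.
    have e2 : 0 < e * (1 - a) / 2 by rewrite divr_gt0// mulr_gt0.
    have [n _ nP] := near_infty_natSinv_lt (PosNum e2).
    have [k nk kp] := pP _ e2 n.
    have := nP _ nk => /= ke.
    have [_ Rq _ kx] := fP k.
    exists (f k).2 => //.
    rewrite -(ltr_pM2l a1n) -{1}(ger0_norm (ltW a1n)) edistE -enormZ.
    have -> : (1 - a) *: ((f k).2 - (1 - a)^-1 *: (x - a *: p)) =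
        (a *: (f k).1 + (1 - a) *: (f k).2 - x) + a *: (p - (f k).1).
      by apply/rowP => i; rewrite !mxE; field; exact: lt0r_neq0.
    apply: le_lt_trans (enormD _ _) _.
    rewrite enormZ (ger0_norm a0') -!edistE (edistC p).
    have : a * edist (f k).1 p <= edist (f k).1 p by rewrite ler_piMl// edist_ge0.
    have := lt_trans kx ke; move: kp; lra.
  - apply: ler_eps => e /pP/(_ 0%N)[k _ kp].
    have [_ _ kw _] := fP k.
    apply: le_trans (edist_triangle (f k).1 _ _) _.
    by rewrite addrC lerD// edistC ltW.
  - by apply/rowP => i; rewrite !mxE; field; exact: lt0r_neq0.
have [|e Ee eF] := fixed_point_of_invariant _ cE vE E0 EPhi.
  by move=> x [[]].
(* Recurrence makes [z] one of its own omega-limit points. *)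
have [p [q [Rp Rq pz ee]]] := Ee.2 _ zz.
by exists a, p, q, e; split=> //; split=> //; exact: Ee.1.1.
Qed.

Let Omega := omega_limit K Phi.

Lemma recurrent_inj t p q : 0 <= t -> recurrent p -> recurrent q ->
  Phi t p = Phi t q -> p = q.
Proof.
move=> t0 Rp Rq pq; apply: edist_eq0.
by rewrite -(recurrent_isometry t0 Rp Rq) pq edistxx.
Qed.

Lemma recurrent_preimage t p : 0 <= t -> recurrent p ->
  exists2 q, recurrent q & Phi t q = p.
Proof.
move=> t0 [Kp pR]; have [q pq qp] := omega_point_preimage t0 Kp pR.
by exists q => //; exact: omega_point_recurrent pq.
Qed.

Lemma recurrent_bij t : 0 <= t -> set_bij Omega Omega (Phi t).
Proof.
move=> t0; split.
- by move=> z /omega_limit_recurrent Rz; apply/omega_limit_recurrent/recurrent_Phi.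
- move=> p q /set_mem/omega_limit_recurrent Rp /set_mem/omega_limit_recurrent Rq.
  exact: recurrent_inj.
- move=> z /omega_limit_recurrent/(recurrent_preimage t0)[w Rw wz].
  by exists w => //; exact/omega_limit_recurrent.
Qed.

(* Every point of Omega is reached from the past at time T, which reduces
   two-sided trajectories to forward ones. *)
Lemma two_sidedE T t z w : 0 <= T -> 0 <= t + T -> recurrent w -> Phi T w = z ->
  two_sided Omega Phi t z = Phi (t + T) w.
Proof.
move=> T0 tT Rw wz; have Kw := Rw.1; rewrite /two_sided; case: ifPn => [t0|].
  by rewrite -wz PhiD.
rewrite -ltNge => tn; have t0 : 0 <= - t by rewrite oppr_ge0 ltW.
have -> : z = Phi (- t) (Phi (t + T) w) by rewrite -PhiD// addKr.
have [_ inj _] := recurrent_bij t0.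
by rewrite pinvKV//; apply/mem_set/omega_limit_recurrent/recurrent_Phi.
Qed.

Lemma two_sided_flow : flow Omega (two_sided Omega Phi).
Proof.
have past z T : 0 <= T -> Omega z -> exists2 w, recurrent w & Phi T w = z.
  by move=> T0 /omega_limit_recurrent; exact: recurrent_preimage.
have nge (t : R) : 0 <= t + `|t| by rewrite addrC -lerBlDr sub0r lerNl lerNnormlW.
split.
- move=> t z _ Oz; have [w Rw wz] := past z _ (normr_ge0 t) Oz.
  rewrite (two_sidedE _ _ Rw wz)//.
  exact/omega_limit_recurrent/recurrent_Phi.
- by move=> z /omega_limit_recurrent[Kz _]; rewrite /two_sided lexx Phi0.
- move=> t s z _ _ Oz; have T0 := addr_ge0 (normr_ge0 t) (normr_ge0 s).
  have [w Rw wz] := past z _ T0 Oz.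
  have sT : 0 <= s + (`|t| + `|s|) by rewrite addrCA addr_ge0.
  have tsT : 0 <= t + (s + (`|t| + `|s|)).
    by rewrite addrCA (addrA t) (addrCA s) addr_ge0.
  rewrite (two_sidedE (T := `|t| + `|s|) _ sT Rw wz)//.
  rewrite (two_sidedE (T := s + (`|t| + `|s|)) sT _ Rw erefl)//.
  by rewrite (two_sidedE (T := `|t| + `|s|) T0 _ Rw wz) -addrA.
- apply/subspace_continuousP => -[t z] [_ /= Oz].
  (* Starting [|t| + 1] earlier keeps the shifted time nonnegative for every [s] within 1 of [t]. *)
  have [w Rw wz] := past z (`|t| + 1) (addr_ge0 (normr_ge0 t) ler01) Oz.
  have T0 : 0 <= `|t| + 1 by rewrite addr_ge0.
  move=> A /nbhs_edistP[d d0 dA].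
  have d2 : 0 < d / 2 by rewrite divr_gt0.
  have [h h0 hP] := nes_time_continuous H (t + 1 + (`|t| + 1)) Rw.1 d2.
  have h1 : 0 < Num.min h 1 by rewrite lt_min h0 ltr01.
  exists (ball t (Num.min h 1), [set y | edist y z < d / 2]) => /=.
    by split; [exact: nbhsx_ballx|apply/nbhs_edistP; exists (d / 2)].
  move=> [s y] [/= ts yz] [_ Oy]; apply: dA => /=.
  move: ts; rewrite -ball_normE /= lt_min => /andP[tsh ts1].
  have sT : 0 <= s + (`|t| + 1).
    by move: ts1; rewrite ltr_norml => /andP[_]; have := nge t; lra.
  have tT : 0 <= t + (`|t| + 1) by have := nge t; lra.
  have [v Rv vy] := past y (`|t| + 1) T0 Oy.
  rewrite /from_subspace /= (two_sidedE T0 sT Rv vy) (two_sidedE T0 tT Rw wz).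
  apply: le_lt_trans (edist_triangle (Phi (s + (`|t| + 1)) w) _ _) _.
  rewrite [ltRHS]splitr ltrD//.
    rewrite (recurrent_isometry sT Rv Rw) -(recurrent_isometry T0 Rv Rw).
    by rewrite vy wz.
  move: tsh ts1; rewrite !ltr_norml => /andP[h1' h2'] /andP[h3' h4'].
  have [st|/ltW st] := leP s t.
    by rewrite edistC; apply: hP => //; rewrite ?lerD2r//; lra.
  by apply: hP => //; rewrite ?lerD2r//; lra.
Qed.

Lemma nonexpansive_flow_of_isometries : defines_flow_of_isometries Omega Phi.
Proof.
split; last exact: two_sided_flow.
move=> t t0; split; first exact: recurrent_bij.
move=> z w /omega_limit_recurrent Rz /omega_limit_recurrent Rw.
exact: recurrent_isometry.
Qed.

Lemma omega_limit_convex : convex_set Omega.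
Proof.
apply/convex_set_cvx => t p q t0 t1.
move=> /omega_limit_recurrent Rp /omega_limit_recurrent Rq.
exact/omega_limit_recurrent/recurrent_cvx.
Qed.

End NonexpansiveSemiflow.

Arguments recurrent {R N} K Phi p.

(** * Absolutely continuous functions *)

Section AbsolutelyContinuousGrowth.
Context {R : realType}.
Implicit Types (a b c t s : R) (h : R -> R) (U : set R).
Local Notation mu := (@lebesgue_measure R).

Definition ac_on a b h : Prop := forall e : R, 0 < e -> exists2 d : R, 0 < d &
  forall (k : nat) (l r : 'I_k -> R),
    (forall i, [/\ a <= l i, l i <= r i & r i <= b]) ->
    trivIset [set: 'I_k] (fun i => `]l i, r i[%classic) ->
    \sum_(i < k) (r i - l i) < d ->
    \sum_(i < k) `|h (r i) - h (l i)| < e.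

(** Bounds the difference quotients on both sides of [t], without division. *)
Definition slope_le h c t : Prop := exists2 d : R, 0 < d &
  forall s, `|s - t| < d ->
    (t <= s -> h s - h t <= c * (s - t)) /\ (s <= t -> h t - h s <= c * (t - s)).

(* [h] grows on [a, t] at most at rate [c] plus its increments over disjoint
   intervals contained in [U]. *)
Definition covered_growth U a c h t : Prop :=
  exists k (l r : 'I_k -> R),
  [/\ forall i, [/\ a <= l i, l i <= r i & r i <= t],
      trivIset [set: 'I_k] (fun i => `]l i, r i[%classic),
      forall i, `]l i, r i[%classic `<=` U &
      h t - h a <= c * (t - a) +
        \sum_(i < k) (`|h (r i) - h (l i)| + `|c| * (r i - l i))].

Lemma covered_growth_slope U a c h t s : t <= s -> h s - h t <= c * (s - t) ->
  covered_growth U a c h t -> covered_growth U a c h s.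
Proof.
move=> ts hs [k [l [r [lr tr lrU ht]]]]; exists k, l, r; split=> //; last lra.
by move=> i; have [? ? ?] := lr i; split=> //; exact: le_trans ts.
Qed.

(** The new interval is put in front of the family; its term [|c| * (s - t)] compensates for a
    negative [c]. *)
Lemma covered_growth_jump U a c h t s : a <= t -> t <= s ->
  `]t, s[%classic `<=` U ->
  covered_growth U a c h t -> covered_growth U a c h s.
Proof.
move=> at_ ts tsU [k [l [r [lr tr lrU ht]]]].
exists k.+1, (fun i => if unlift ord0 i is Some j then l j else t),
  (fun i => if unlift ord0 i is Some j then r j else s); split.
- move=> i; case: unliftP => [j|] _ //.
  by have [? ? ?] := lr j; split=> //; exact: le_trans ts.
- move=> i i' _ _; case: unliftP => [j|] ->; case: unliftP => [j'|] -> //.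
  + by move=> h'; congr lift; exact: tr.
  + move=> [x []]; rewrite /= !in_itv /= => /andP[_ xr] /andP[tx _].
    by have [_ _ rt] := lr j; have := lt_le_trans xr rt; rewrite ltNge (ltW tx).
  + move=> [x []]; rewrite /= !in_itv /= => /andP[tx _] /andP[_ xr].
    by have [_ _ rt] := lr j'; have := lt_le_trans xr rt; rewrite ltNge (ltW tx).
- by move=> i; case: unliftP => [j|].
- rewrite big_ord_recl unlift_none.
  under eq_bigr do rewrite liftK.
  have h1 := ler_norm (h s - h t).
  have h2 : - `|c| * (s - t) <= c * (s - t).
    by rewrite ler_wpM2r ?subr_ge0// lerNnormlW.
  move: ht h2; lra.
Qed.

Lemma sum_itv_lt_measure U (d : R) k (l r : 'I_k -> R) :
  open U -> (mu U < d%:E)%E -> (forall i, l i <= r i) ->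
  trivIset [set: 'I_k] (fun i => `]l i, r i[%classic) ->
  (forall i, `]l i, r i[%classic `<=` U) -> \sum_(i < k) (r i - l i) < d.
Proof.
move=> oU Ud lr tr lrU; rewrite -lte_fin; apply: le_lt_trans Ud.
have mitv i : measurable (`]l i, r i[%classic : set R) by exact: measurable_itv.
have -> : (\sum_(i < k) (r i - l i))%:E = mu (\big[setU/set0]_(i < k) `]l i, r i[%classic).
  rewrite measure_semi_additive_ord//; last by apply: bigsetU_measurable.
  rewrite -sumEFin; apply: eq_bigr => i _; apply/esym.
  apply: etrans (lebesgue_measure_itv _) _; rewrite /= lte_fin.
  case: ltP => [|rl]; first by rewrite EFinB.
  by rewrite (_ : l i = r i) ?subrr//; apply/eqP; rewrite eq_le lr rl.
apply: le_measure; rewrite ?inE.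
- by apply: bigsetU_measurable.
- exact: measurable_realfun.open_measurable.
- apply: (big_ind (fun A => A `<=` U)) => // A B AU BU.
  by rewrite subUset.
Qed.

Lemma negligible_open_cover (A : set R) (d : R) : 0 < d -> mu.-negligible A ->
  exists U, [/\ open U, A `<=` U & (mu U < d%:E)%E].
Proof.
move=> d0 [B [mB B0 AB]].
have B00 : (mu B < +oo)%E by rewrite B0.
have [U [oU BU UB]] := lebesgue_regularity_outer mB B00 d0.
exists U; split=> //; first exact: subset_trans BU.
have mU : measurable U := measurable_realfun.open_measurable oU.
have -> : mu U = (mu (U `\` B) + mu (U `&` B))%E by exact: measureDI.
by rewrite (setIidr BU) B0 adde0.
Qed.

(** A supremum argument walks from [a] to [b], by slopes where they are bounded and by jumps inside
    an open set [U] of small measure covering the exceptional points; absolute continuity makes the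
    jumps negligible. *)
Lemma ac_growth a b c h : a <= b -> ac_on a b h ->
  {ae mu, forall t, a < t < b -> slope_le h c t} -> h b - h a <= c * (b - a).
Proof.
move=> ab ach hae; apply: ler_eps => e e0.
have e2 : 0 < e / 2 by rewrite divr_gt0.
have [d d0 dP] := ach _ e2.
have c1 : 0 < `|c| + 1 by rewrite ltr_wpDl.
(* Bounds by [e / 2] both the increments of [h] over the jumps and [|c|] times the total length of
   the jumps. *)
pose d' := Num.min d (e / 2 / (`|c| + 1)).
have d'0 : 0 < d' by rewrite lt_min d0 divr_gt0.
(* The end points join the exceptional set because slopes are bounded only in the open interval. *)
pose E := ~` [set t | a < t < b -> slope_le h c t] `|` ([set a] `|` [set b]).
have [|U [oU EU Ud]] := @negligible_open_cover E d' d'0.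
  apply: negligibleU; first exact: hae.
  by apply: negligibleU; apply/negligibleP => //; exact: lebesgue_measure_set1.
pose S := [set t | [/\ a <= t, t <= b & covered_growth U a c h t]].
have Sa : S a.
  split=> //; exists 0%N, (fun=> a), (fun=> a); split=> //; try by case.
  by rewrite big_ord0 !subrr mulr0 addr0.
have supS : has_sup S by split; [exists a|exists b => t []].
(* Around every point of the interval, membership in [S] passes from left to right. *)
have local t : a <= t <= b -> exists2 q : R, 0 < q & forall r s, S r -> t - q < r ->
    r <= t -> t <= s -> s < t + q -> s <= b -> S s.
  move=> /andP[at_ tb]; have [Et|/not_orP[]] := pselect (E t).
    have /nbhs_ballP[q /= q0 qU] : nbhs t U.
      by move: oU; rewrite openE; apply; exact: EU.
    exists q => // r s [ar rb Sr] qr rt ts sq sb.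
    split=> //; first exact: le_trans ts.
    apply: covered_growth_jump (Sr) => //; first exact: le_trans ts.
    move=> x /=; rewrite in_itv /= => /andP[rx xs]; apply: qU.
    by rewrite -ball_normE /= ltr_norml; lra.
  move=> /contrapT /= slope /not_orP[ta tb'].
  have [|q q0 qP] := slope.
    by rewrite !lt_neqAle at_ tb !andbT eq_sym; apply/andP; split; apply/eqP.
  exists q => // r s [ar rb Sr] qr rt ts sq sb.
  split=> //; first exact: le_trans ts.
  have rq : `|r - t| < q by rewrite ltr_norml; lra.
  have sq' : `|s - t| < q by rewrite ltr_norml; lra.
  have [_ /(_ rt) h1] := qP _ rq; have [/(_ ts) h2 _] := qP _ sq'.
  apply: (covered_growth_slope _ _ Sr); first exact: le_trans ts.
  by move: h1 h2; lra.
pose m := sup S.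
have mab : a <= m <= b.
  apply/andP; split; first exact: (sup_upper_bound supS).
  by apply: ge_sup; [exists a|move=> t []].
have [q q0 qP] := local m mab.
have [r Sr mr] := sup_adherent q0 supS.
have rm : r <= m by exact: (sup_upper_bound supS).
have [am mb] := andP mab.
(* If [b] were beyond the local step from [sup S], that step would lead past the supremum. *)
have {qP} Sb : S b.
  have [bq|qb] := ltP b (m + q); first exact: (qP r b).
  have : S (m + q / 2) by apply: (qP r _) => //; lra.
  by move/(sup_upper_bound supS); rewrite -/m; lra.
have [_ _ [k [l [r' [lr tr lrU hb]]]]] := Sb.
have sumd' : \sum_(i < k) (r' i - l i) < d'.
  by apply: (sum_itv_lt_measure oU Ud) => // i; have [] := lr i.
have [sumd sume] : \sum_(i < k) (r' i - l i) < d /\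
    \sum_(i < k) (r' i - l i) < e / 2 / (`|c| + 1).
  by move: sumd'; rewrite lt_min => /andP.
have := dP k l r' lr tr sumd.
move: sume; rewrite ltr_pdivlMr// => h1 h2.
move: hb; rewrite big_split /= -mulr_sumr.
have h3 : 0 <= \sum_(i < k) (r' i - l i).
  by apply: sumr_ge0 => i _; rewrite subr_ge0; have [] := lr i.
move: h1 h2; lra.
Qed.

End AbsolutelyContinuousGrowth.

(** * Differential calculus and the saddle field *)

Section ContinuouslyDifferentiable.
Context {R : realType} {N : nat}.
Implicit Types (g : 'rV[R]_N -> R) (u v w z : 'rV[R]_N).
Local Notation e_ i := (delta_mx ord0 i : 'rV[R]_N).

Definition C1_at g z : Prop :=
  (\forall w \near z, forall i, derivable g w (e_ i)) /\
  (forall i, {for z, continuous ('D_(e_ i) g)}).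

Lemma C2_on_C1 (K : set 'rV[R]_N) g : C2_on K g -> forall z, K z -> C1_at g z.
Proof.
move=> [U [oU KU gU]] z Kz; split=> [|i]; last first.
  by have [_ /(_ i)[]] := gU z (KU z Kz).
have : nbhs z U by move: oU; rewrite openE; apply; exact: KU.
apply: filterS => w Uw i.
by have [_ /(_ i)[]] := gU w Uw.
Qed.

Lemma C1_atP g z : C1_at g z -> forall e : R, 0 < e ->
  exists2 d : R, 0 < d & forall w, edist w z < d ->
    forall i, derivable g w (e_ i) /\ `|'D_(e_ i) g w - 'D_(e_ i) g z| < e.
Proof.
move=> [gd gc] e e0.
have : \forall w \near z, forall i,
    derivable g w (e_ i) /\ `|'D_(e_ i) g w - 'D_(e_ i) g z| < e.
  have gn : \forall w \near z, forall i, `|'D_(e_ i) g w - 'D_(e_ i) g z| < e.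
    apply: (@filter_forall _ _ _ (nbhs z)) => i.
    have /cvgrPdist_lt/(_ _ e0) h := gc i.
    by apply: filterS h => w; rewrite distrC.
  by apply: filterS2 gd gn => w hd hn i; split.
by move=> /nbhs_edistP.
Qed.

Lemma is_derive_line g w v (t : R) : derivable g (w + t *: v) v ->
  is_derive t 1 (fun s : R => g (w + s *: v)) ('D_v g (w + t *: v)).
Proof.
have E : (fun h : R => h^-1 *: (((fun s : R => g (w + s *: v)) \o shift t) (h *: 1) -
      g (w + t *: v))) =
    (fun h : R => h^-1 *: ((g \o shift (w + t *: v)) (h *: v) - g (w + t *: v))).
  apply/funext => h; congr (_ *: (g _ - _)) => /=.
  by rewrite scalerDl addrCA /GRing.scale /= mulr1.
by move=> gv; split; rewrite /derivable/derive E.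
Qed.

Lemma mean_value_approx (f df : R -> R) (a b c e : R) : a <= b ->
  (forall t, a <= t <= b -> is_derive t 1 f (df t) /\ `|df t - c| <= e) ->
  `|f b - f a - c * (b - a)| <= e * (b - a).
Proof.
move=> ab fP; have [||t] := @MVT_segment _ f df a b ab.
- by move=> t; rewrite in_itv /= => /andP[at_ tb]; have [|//] := fP t; rewrite !ltW.
- apply: derivable_within_continuous => t; rewrite in_itv /= => tab.
  by have [h _] := fP t tab; exact: ex_derive.
rewrite in_itv /= => tab ->; rewrite -mulrBl normrM [`|b - a|]ger0_norm ?subr_ge0//.
by rewrite ler_wpM2r ?subr_ge0//; have [] := fP t tab.
Qed.

Lemma line_approx g w v (s c e : R) :
  (forall t, `|t| <= `|s| -> derivable g (w + t *: v) v /\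
                             `|'D_v g (w + t *: v) - c| <= e) ->
  `|g (w + s *: v) - g w - s * c| <= e * `|s|.
Proof.
move=> gP; have [s0|/ltW s0] := leP 0 s.
  have := @mean_value_approx (fun t => g (w + t *: v)) (fun t => 'D_v g (w + t *: v)) 0 s c e s0.
  rewrite subr0 scale0r addr0 (mulrC c) (ger0_norm s0); apply => t /andP[t0 ts].
  have [|gd gc] := gP t; first by rewrite !ger0_norm.
  by split=> //; exact: is_derive_line.
have := @mean_value_approx (fun t => g (w + t *: v)) (fun t => 'D_v g (w + t *: v)) s 0 c e s0.
rewrite sub0r scale0r addr0 (ler0_norm s0) -normrN => h.
have -> : g (w + s *: v) - g w - s * c = - (g w - g (w + s *: v) - c * - s) by ring.
apply: h => t /andP[st t0].
have [|gd gc] := gP t; first by rewrite !ler0_norm// lerN2.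
by split=> //; exact: is_derive_line.
Qed.

(** Vertices of the path from 0 to [u] parallel to the coordinate axes. *)
Definition trunc_vec (k : nat) u : 'rV[R]_N := \row_i (if (i < k)%N then u ord0 i else 0).

Lemma trunc_vecS k u (kN : (k < N)%N) :
  trunc_vec k.+1 u = trunc_vec k u + u ord0 (Ordinal kN) *: e_ (Ordinal kN).
Proof.
apply/rowP => i; rewrite !mxE /= ltnS leq_eqVlt.
have [ik|ik] := eqVneq (i : nat) k.
  rewrite ik ltnn add0r.
  have -> : i = Ordinal kN by apply: val_inj.
  by rewrite eqxx mulr1.
suff -> : (i == Ordinal kN) = false by rewrite mulr0 addr0.
by apply/negbTE; apply: contra ik => /eqP ->.
Qed.

(** Continuous partial derivatives give differentiability: each edge of the path [trunc_vec k u]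
    changes one coordinate and is estimated by the mean value theorem. *)
Lemma C1_expansion g z : C1_at g z -> forall e : R, 0 < e ->
  exists2 d : R, 0 < d & forall u, \sum_i `|u ord0 i| < d ->
    `|g (z + u) - g z - dotp (gradient g z) u| <= e * \sum_i `|u ord0 i|.
Proof.
move=> gz e e0; have [d d0 dP] := C1_atP gz e0; exists d => // u ud.
have trP k (kN : (k < N)%N) (t : R) : `|t| <= `|u ord0 (Ordinal kN)| ->
    edist (z + trunc_vec k u + t *: e_ (Ordinal kN)) z < d.
  move=> tu; apply: le_lt_trans ud; rewrite edistE.
  have -> : z + trunc_vec k u + t *: e_ (Ordinal kN) - z =
      trunc_vec k u + t *: e_ (Ordinal kN).
    by apply/eqP; rewrite subr_eq -addrA addrC.
  apply: le_trans (enorm_le_sum _) _; apply: ler_sum => i _.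
  rewrite !mxE /=; have [->|ik] := eqVneq i (Ordinal kN).
    by rewrite /= ltnn add0r mulr1.
  by rewrite mulr0 addr0; case: ifP => // _; rewrite normr0.
have partial k : (k <= N)%N ->
    `|g (z + trunc_vec k u) - g z - dotp (gradient g z) (trunc_vec k u)| <=
    e * \sum_i `|trunc_vec k u ord0 i|.
  elim: k => [_|k IH kN].
    have -> : trunc_vec 0 u = 0 by apply/rowP => i; rewrite !mxE.
    rewrite addr0 subrr dotp0r subrr normr0 mulr_ge0 ?(ltW e0)//.
    exact: sumr_ge0.
  have -> : \sum_i `|trunc_vec k.+1 u ord0 i| =
      \sum_i `|trunc_vec k u ord0 i| + `|u ord0 (Ordinal kN)|.
    rewrite (bigD1 (Ordinal kN)) //= [in RHS](bigD1 (Ordinal kN)) //= addrAC.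
    congr (_ + _); first by rewrite !mxE /= ltnSn ltnn normr0 add0r.
    apply: eq_bigr => i ik; rewrite !mxE ltnS leq_eqVlt.
    suff -> : (i == k :> nat) = false by [].
    by apply/negbTE; apply: contra ik => /eqP ik; apply/eqP/val_inj.
  have -> : dotp (gradient g z) (trunc_vec k.+1 u) = dotp (gradient g z) (trunc_vec k u) +
      u ord0 (Ordinal kN) * 'D_(e_ (Ordinal kN)) g z.
    rewrite trunc_vecS dotpDr dotpZr; congr (_ + _ * _).
    rewrite /dotp (bigD1 (Ordinal kN)) //= big1 => [|i ik].
      by rewrite !mxE !eqxx mulr1 addr0.
    by rewrite !mxE /= (negbTE ik) mulr0.
  rewrite trunc_vecS addrA.
  have := @line_approx g (z + trunc_vec k u) (e_ (Ordinal kN)) (u ord0 (Ordinal kN))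
    ('D_(e_ (Ordinal kN)) g z) e _.
  move=> h; have {h} : `|g (z + trunc_vec k u + u ord0 (Ordinal kN) *: e_ (Ordinal kN)) -
      g (z + trunc_vec k u) - u ord0 (Ordinal kN) * 'D_(e_ (Ordinal kN)) g z| <=
      e * `|u ord0 (Ordinal kN)|.
    by apply: h => t tu; have [? /ltW] := dP _ (trP k kN t tu) (Ordinal kN).
  have := IH (ltnW kN); set A := g (z + trunc_vec k u); set B := g (_ + _ *: _).
  set D1 := dotp _ _; set D2 := _ * 'D_ _ g z => h1 h2.
  have -> : B - g z - (D1 + D2) = (B - A - D2) + (A - g z - D1) by ring.
  rewrite mulrDr addrC; apply: le_trans (ler_normD _ _) _; exact: lerD.
have := partial N (leqnn N).
suff -> : trunc_vec N u = u by [].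
by apply/rowP => i; rewrite mxE ltn_ord.
Qed.

Lemma slope_expansion g z u : C1_at g z -> forall e : R, 0 < e ->
  exists t : R, [/\ 0 < t, t <= 1 &
    `|g (z + t *: u) - g z - t * dotp (gradient g z) u| <= e * t].
Proof.
move=> gz e e0; pose s := \sum_i `|u ord0 i|.
have s0 : 0 <= s by apply: sumr_ge0.
have s1 : 0 < s + 1 by rewrite ltr_wpDl.
have [d d0 dP] := C1_expansion gz (divr_gt0 e0 s1).
pose t := Num.min 1 (d / (s + 1)).
have t0 : 0 < t by rewrite lt_min ltr01 divr_gt0.
have st : \sum_i `|(t *: u) ord0 i| = t * s.
  by rewrite mulr_sumr; apply: eq_bigr => i _; rewrite mxE normrM (gtr0_norm t0).
exists t; split=> //; first by rewrite ge_min lexx.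
have := dP (t *: u); rewrite st dotpZr => h.
apply: le_trans (h _) _.
  have : t * (s + 1) <= d by rewrite -ler_pdivlMr// ge_min lexx orbT.
  by move: t0; lra.
rewrite mulrAC ler_pdivrMr// -!mulrA ler_pM2l// ler_pM2l//; lra.
Qed.

(** Turns the chord bounds given by concavity or by a saddle point into a bound for the gradient, by
    shrinking the chord. *)
Lemma gradient_ge g z u (A : R) : C1_at g z ->
  (forall t, 0 <= t -> t <= 1 -> t * A <= g (z + t *: u) - g z) ->
  A <= dotp (gradient g z) u.
Proof.
move=> gz gA; apply: ler_eps => e e0.
have [t [t0 t1]] := slope_expansion u gz e0; rewrite ler_norml => /andP[_ h].
by rewrite -(ler_pM2l t0); have := gA t (ltW t0) t1; move: h; lra.
Qed.

Lemma gradient_le g z u (A : R) : C1_at g z ->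
  (forall t, 0 <= t -> t <= 1 -> g (z + t *: u) - g z <= t * A) ->
  dotp (gradient g z) u <= A.
Proof.
move=> gz gA; apply: ler_eps => e e0.
have [t [t0 t1]] := slope_expansion u gz e0; rewrite ler_norml => /andP[h _].
by rewrite -(ler_pM2l t0); have := gA t (ltW t0) t1; move: h; lra.
Qed.

End ContinuouslyDifferentiable.

(** * Concave-convex functions and their saddle field *)

Section SaddleField.
Context {R : realType} {n m : nat}.
Implicit Types (z v w a b e : 'rV[R]_(n + m)) (x : 'rV[R]_n) (y : 'rV[R]_m).

Lemma convex_functionP (k : nat) (A : set 'rV[R]_k) (g : 'rV[R]_k -> R) :
  convex_function A g <-> forall (t : R) p q, 0 <= t -> t <= 1 -> A p -> A q ->
    g (t *: p + (1 - t) *: q) <= t * g p + (1 - t) * g q.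
Proof.
split=> [gA t p q t0 t1 /mem_set Ap /mem_set Aq|gA t p q /set_mem Ap /set_mem Aq].
  exact: gA (Itv01 t0 t1) p q Ap Aq.
by apply: gA.
Qed.

Context {Dx : set 'rV[R]_n} {Dy : set 'rV[R]_m} {phi : 'rV[R]_n -> 'rV[R]_m -> R}.
Context (phiD : concave_convex Dx Dy phi).

Lemma concave_left t x x' y : 0 <= t -> t <= 1 -> Dx x -> Dx x' -> Dy y ->
  t * phi x y + (1 - t) * phi x' y <= phi (t *: x + (1 - t) *: x') y.
Proof.
move=> t0 t1 Dx_x Dx_x' Dy_y.
have /convex_functionP/(_ t x x' t0 t1 Dx_x Dx_x') := phiD.1 y Dy_y; lra.
Qed.

Lemma convex_right t x y y' : 0 <= t -> t <= 1 -> Dx x -> Dy y -> Dy y' ->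
  phi x (t *: y + (1 - t) *: y') <= t * phi x y + (1 - t) * phi x y'.
Proof.
move=> t0 t1 Dx_x Dy_y Dy_y'.
by have /convex_functionP/(_ t y y' t0 t1 Dy_y Dy_y') := phiD.2 x Dx_x.
Qed.

Lemma saddle_points_convex (vDx : cvx Dx) (vDy : cvx Dy) :
  cvx (saddle_points (prod_set Dx Dy) phi).
Proof.
move=> t a b t0 t1 [[/= ax ay] aS] [[/= bx by_] bS].
have h1 : phi (lsubmx b) (rsubmx a) <= phi (lsubmx a) (rsubmx a) <= phi (lsubmx a) (rsubmx b).
  by apply: aS; split; rewrite ?row_mxKl ?row_mxKr.
have h2 : phi (lsubmx a) (rsubmx b) <= phi (lsubmx b) (rsubmx b) <= phi (lsubmx b) (rsubmx a).
  by apply: bS; split; rewrite ?row_mxKl ?row_mxKr.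
have lE : lsubmx (t *: a + (1 - t) *: b) = t *: lsubmx a + (1 - t) *: lsubmx b.
  by rewrite linearD /= !linearZ.
have rE : rsubmx (t *: a + (1 - t) *: b) = t *: rsubmx a + (1 - t) *: rsubmx b.
  by rewrite linearD /= !linearZ.
(* The inequalities [h1] and [h2] form a cycle, so [a], [b] and the two mixed points all have the
   value [c]. *)
pose c := phi (lsubmx a) (rsubmx a).
have ub x : Dx x -> phi x (rsubmx (t *: a + (1 - t) *: b)) <= c.
  move=> Dx_x; rewrite rE; apply: le_trans (convex_right t0 t1 Dx_x ay by_) _.
  have /andP[ha _] : phi x (rsubmx a) <= phi (lsubmx a) (rsubmx a) <= phi (lsubmx a) (rsubmx a).
    by apply: aS; split; rewrite ?row_mxKl ?row_mxKr.
  have /andP[hb _] : phi x (rsubmx b) <= phi (lsubmx b) (rsubmx b) <= phi (lsubmx b) (rsubmx b).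
    by apply: bS; split; rewrite ?row_mxKl ?row_mxKr.
  have hbc : phi x (rsubmx b) <= c by rewrite /c; lra.
  have t1' : 0 <= 1 - t by rewrite subr_ge0.
  have := ler_wpM2l t0 ha; have := ler_wpM2l t1' hbc; rewrite /c; lra.
have lb y : Dy y -> c <= phi (lsubmx (t *: a + (1 - t) *: b)) y.
  move=> Dy_y; rewrite lE; apply: le_trans (concave_left t0 t1 ax bx Dy_y).
  have /andP[_ ha] : phi (lsubmx a) (rsubmx a) <= phi (lsubmx a) (rsubmx a) <= phi (lsubmx a) y.
    by apply: aS; split; rewrite ?row_mxKl ?row_mxKr.
  have /andP[_ hb] : phi (lsubmx b) (rsubmx b) <= phi (lsubmx b) (rsubmx b) <= phi (lsubmx b) y.
    by apply: bS; split; rewrite ?row_mxKl ?row_mxKr.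
  have hbc : c <= phi (lsubmx b) y by rewrite /c; lra.
  have t1' : 0 <= 1 - t by rewrite subr_ge0.
  have := ler_wpM2l t0 ha; have := ler_wpM2l t1' hbc; rewrite /c; lra.
have Dl : Dx (lsubmx (t *: a + (1 - t) *: b)) by rewrite lE; exact: vDx.
have Dr : Dy (rsubmx (t *: a + (1 - t) *: b)) by rewrite rE; exact: vDy.
split=> // x y [+ _] [_ +]; rewrite row_mxKl row_mxKr => Dx_x Dy_y.
apply/andP; split; first exact: le_trans (ub _ Dx_x) (lb _ Dr).
exact: le_trans (ub _ Dl) (lb _ Dy_y).
Qed.

Local Notation g := (fun z : 'rV[R]_(n + m) => phi (lsubmx z) (rsubmx z)).

Lemma delta_row_mxl (i : 'I_n) :
  delta_mx ord0 (lshift m i) = row_mx (delta_mx ord0 i) 0 :> 'rV[R]_(n + m).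
Proof.
apply/rowP => j; rewrite !mxE; case: split_ordP => k ->; rewrite !mxE.
  by rewrite (inj_eq (@lshift_inj _ _)).
by rewrite eq_rlshift.
Qed.

Lemma delta_row_mxr (i : 'I_m) :
  delta_mx ord0 (rshift n i) = row_mx 0 (delta_mx ord0 i) :> 'rV[R]_(n + m).
Proof.
apply/rowP => j; rewrite !mxE; case: split_ordP => k ->; rewrite !mxE.
  by rewrite eq_lrshift.
by rewrite (inj_eq (@rshift_inj _ _)).
Qed.

(** The two functions may live in different dimensions, so partial derivatives on a factor can be
    identified with those on the product. *)
Lemma derive_congr (k l : nat) (p : 'rV[R]_k -> R) (q : 'rV[R]_l -> R)
    (a u : 'rV[R]_k) (b v : 'rV[R]_l) :
  (forall h : R, p (h *: u + a) = q (h *: v + b)) -> 'D_u p a = 'D_v q b.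
Proof.
move=> pq; have := pq 0; rewrite !scale0r !add0r /derive => ->.
have -> : (fun h : R => h^-1 *: ((p \o shift a) (h *: u) - q b)) =
    (fun h : R => h^-1 *: ((q \o shift b) (h *: v) - q b)).
  by apply/funext => h /=; rewrite pq.
by [].
Qed.

Lemma saddle_fieldE z : saddle_field phi z =
  row_mx (lsubmx (gradient g z)) (- rsubmx (gradient g z)).
Proof.
congr row_mx; [|congr (- _)]; apply/rowP => i; rewrite !mxE; apply: derive_congr => h.
  by rewrite delta_row_mxl !linearD !linearZ /= row_mxKl row_mxKr scaler0 add0r.
by rewrite delta_row_mxr !linearD !linearZ /= row_mxKl row_mxKr scaler0 add0r.
Qed.

Lemma dotp_row_mx (x x' : 'rV[R]_n) (y y' : 'rV[R]_m) :
  dotp (row_mx x y) (row_mx x' y') = dotp x x' + dotp y y'.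
Proof.
rewrite /dotp big_split_ord /=; congr (_ + _); apply: eq_bigr => i _.
  by rewrite !row_mxEl.
by rewrite !row_mxEr.
Qed.

Lemma dotp_saddle_field z v : dotp (saddle_field phi z) v =
  dotp (gradient g z) (row_mx (lsubmx v) 0) - dotp (gradient g z) (row_mx 0 (rsubmx v)).
Proof.
rewrite saddle_fieldE -{1}(hsubmxK v) -[in RHS](hsubmxK (gradient g z)) !dotp_row_mx.
by rewrite dotpNl !dotp0r addr0 add0r.
Qed.

Context {Kx : set 'rV[R]_n} {Ky : set 'rV[R]_m}.
Context (KDx : Kx `<=` Dx) (KDy : Ky `<=` Dy) (vKx : cvx Kx) (vKy : cvx Ky).
Local Notation K := (prod_set Kx Ky).
Context (C1g : forall z, K z -> C1_at g z).

Lemma prod_cvx : cvx K.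
Proof.
move=> t p q t0 t1 [px py] [qx qy]; split.
  by rewrite linearD !linearZ; exact: vKx.
by rewrite linearD !linearZ; exact: vKy.
Qed.

Lemma barycenterE (k : nat) (p q : 'rV[R]_k) (t : R) :
  p + t *: (q - p) = t *: q + (1 - t) *: p.
Proof. by apply/rowP => i; rewrite !mxE; ring. Qed.

(** Gradient inequalities for the concave and the convex variable; the value at [z] cancels between
    them. *)
Lemma saddle_field_ge z w : K z -> K w ->
  phi (lsubmx w) (rsubmx z) - phi (lsubmx z) (rsubmx w) <=
  dotp (saddle_field phi z) (w - z).
Proof.
move=> Kz Kw; have [zx zy] := Kz; have [wx wy] := Kw.
rewrite dotp_saddle_field !linearB /=.
have h1 : phi (lsubmx w) (rsubmx z) - phi (lsubmx z) (rsubmx z) <=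
    dotp (gradient g z) (row_mx (lsubmx w - lsubmx z) 0).
  apply: gradient_ge (C1g Kz) _ => t t0 t1.
  rewrite !linearD !linearZ /= row_mxKl row_mxKr scaler0 addr0 barycenterE.
  have := concave_left t0 t1 (KDx wx) (KDx zx) (KDy zy); lra.
have h2 : dotp (gradient g z) (row_mx 0 (rsubmx w - rsubmx z)) <=
    phi (lsubmx z) (rsubmx w) - phi (lsubmx z) (rsubmx z).
  apply: gradient_le (C1g Kz) _ => t t0 t1.
  rewrite !linearD !linearZ /= row_mxKl row_mxKr scaler0 addr0 barycenterE.
  have := convex_right t0 t1 (KDx zx) (KDy wy) (KDy zy); lra.
lra.
Qed.

(** The mixed values of [phi] cancel in the sum of two instances of [saddle_field_ge]. *)
Lemma saddle_field_monotone z w : K z -> K w ->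
  dotp (saddle_field phi z - saddle_field phi w) (z - w) <= 0.
Proof.
move=> Kz Kw; have := saddle_field_ge Kz Kw; have := saddle_field_ge Kw Kz.
rewrite dotpBl -[w - z]opprB dotpNr; lra.
Qed.

(** One direction is the first-order condition in each block of variables; the other is
    [saddle_field_ge] at points sharing a block with [e]. *)
Lemma saddle_point_normal e :
  saddle_points K phi e <-> K e /\ normal_cone K e (saddle_field phi e).
Proof.
split=> [[Ke eS]|[Ke eN]]; have [ex ey] := Ke; split=> //.
  move=> w [wx wy]; rewrite dotp_saddle_field !linearB /=.
  have h1 : dotp (gradient g e) (row_mx (lsubmx w - lsubmx e) 0) <= 0.
    apply: gradient_le (C1g Ke) _ => t t0 t1.
    rewrite !linearD !linearZ /= row_mxKl row_mxKr scaler0 addr0 barycenterE mulr0.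
    have := eS (t *: lsubmx w + (1 - t) *: lsubmx e) (rsubmx e).
    rewrite hsubmxK subr_le0 => /(_ _ Ke)/andP[] //.
    by split; rewrite ?row_mxKl ?row_mxKr//; exact: vKx.
  have h2 : 0 <= dotp (gradient g e) (row_mx 0 (rsubmx w - rsubmx e)).
    apply: gradient_ge (C1g Ke) _ => t t0 t1.
    rewrite !linearD !linearZ /= row_mxKl row_mxKr scaler0 addr0 barycenterE mulr0.
    have := eS (lsubmx e) (t *: rsubmx w + (1 - t) *: rsubmx e).
    rewrite hsubmxK subr_ge0 => /(_ Ke) h; apply: (andP (h _)).2.
    by split; rewrite ?row_mxKl ?row_mxKr//; exact: vKy.
  lra.
move=> x y Kx_x Ky_y; apply/andP; split.
  have := eN _ Kx_x; have := saddle_field_ge Ke Kx_x.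
  rewrite row_mxKl row_mxKr; lra.
have := eN _ Ky_y; have := saddle_field_ge Ke Ky_y.
rewrite row_mxKl row_mxKr; lra.
Qed.

Lemma saddle_field_continuous z (d : R) : K z -> 0 < d ->
  exists2 h : R, 0 < h & forall w, edist w z < h ->
    edist (saddle_field phi w) (saddle_field phi z) < d.
Proof.
move=> Kz d0; pose N := (n + m)%N.
have dN : 0 < d / N.+1%:R by rewrite divr_gt0.
have [h h0 hP] := C1_atP (C1g Kz) dN.
exists h => // w wz; have {}hP i := (hP w wz i).2.
have -> : edist (saddle_field phi w) (saddle_field phi z) =
    edist (gradient g w) (gradient g z).
  rewrite !edistE /enorm; congr Num.sqrt; rewrite !saddle_fieldE.
  rewrite -[in RHS](hsubmxK (gradient g w)) -[in RHS](hsubmxK (gradient g z)).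
  rewrite !opp_row_mx !add_row_mx !dotp_row_mx; congr (_ + _).
  by rewrite -opprD dotpNl dotpNr opprK.
rewrite edistE; apply: le_lt_trans (enorm_le_sum _) _.
apply: (@le_lt_trans _ _ (\sum_(i < N) d / N.+1%:R)).
  by apply: ler_sum => i _; rewrite !mxE; exact/ltW/hP.
have -> : \sum_(i < N) d / N.+1%:R = N%:R * (d / N.+1%:R).
  by rewrite sumr_const card_ord mulr_natl.
by rewrite mulrCA gtr_pMr// ltr_pdivrMr// mul1r ltr_nat.
Qed.

End SaddleField.

(** * Derivatives of curves *)

Lemma ae_imp (R : realType) (P Q : R -> Prop) :
  {ae @lebesgue_measure R, forall t, P t} -> (forall t, P t -> Q t) ->
  {ae @lebesgue_measure R, forall t, Q t}.
Proof.
by move=> [A [mA A0 PA]] PQ; exists A; split=> // t nQ; apply: PA => /PQ.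
Qed.

Section ScalarDerivative.
Context {R : realType}.
Implicit Types (h G : R -> R) (a b c t T : R).

(** The difference quotient is cleared of its denominator, so that [s = t] is no exception. *)
Lemma is_deriveP h c t : is_derive t 1 h c <-> forall e : R, 0 < e ->
  exists2 d : R, 0 < d & forall s, `|s - t| < d ->
    `|h s - h t - c * (s - t)| <= e * `|s - t|.
Proof.
pose Q (x : R) := x^-1 *: ((h \o shift t) (x *: 1) - h t).
have QE s : s != t -> h s - h t - c * (s - t) = (Q (s - t) - c) * (s - t).
  move=> st; rewrite /Q /= [(s - t) *: 1]mulr1 subrK mulrBl; congr (_ - _).
  by rewrite /GRing.scale /= mulrC mulrA mulfV ?mul1r// subr_eq0.
split=> [hc e e0|hc].
  have : Q x @[x --> 0^'] --> c.
    by rewrite -(derive_val (is_derive := hc)); exact: ex_derive.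
  move=> /cvgrPdist_le/(_ e e0)[d /= d0 dP]; exists d => // s sd.
  have [->|st] := eqVneq s t; first by rewrite !subrr mulr0 subr0 normr0 mulr0.
  rewrite QE// normrM ler_wpM2r// distrC; apply: dP; last by rewrite subr_eq0.
  by rewrite /ball_ /= sub0r normrN.
have Qc : Q x @[x --> 0^'] --> c.
  apply/cvgrPdist_le => e e0; have [d d0 dP] := hc e e0.
  exists d => //= x; rewrite /ball_ /= sub0r normrN => xd x0.
  have xt : x + t != t by rewrite -subr_eq0 addrK.
  have := dP (x + t); rewrite addrK => /(_ xd).
  have := QE _ xt; rewrite addrK => ->.
  by rewrite normrM ler_pM2r ?normr_gt0// distrC.
by split; [apply/cvg_ex; exists c|exact: cvg_lim Qc].
Qed.

Lemma is_derive_slope h c c' t : is_derive t 1 h c -> c < c' -> slope_le h c' t.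
Proof.
move=> /is_deriveP hc cc'; have [|d d0 dP] := hc (c' - c); first by rewrite subr_gt0.
exists d => // s sd; have := dP s sd; split=> st; move: H; rewrite ler_norml.
  by rewrite (@ger0_norm _ (s - t)) ?subr_ge0// => /andP[_]; lra.
by rewrite (@ler0_norm _ (s - t)) ?subr_le0// => /andP[+ _]; lra.
Qed.

Lemma is_derive_const_on h c t : 0 < t -> (forall s, 0 <= s -> h s = h t) ->
  is_derive t 1 h c -> c = 0.
Proof.
move=> t0 hE /is_deriveP hc; apply/eqP; rewrite -normr_le0; apply: ler_eps => e e0.
have [d d0 dP] := hc e e0.
have p0 : 0 < d / 2 by rewrite divr_gt0.
have := dP (d / 2 + t); rewrite addrK.
rewrite (gtr0_norm p0) hE; last by rewrite addr_ge0// ltW.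
rewrite subrr sub0r normrN normrM (gtr0_norm p0) ler_pM2r// add0r; apply; lra.
Qed.

Lemma ac_onS a b a' b' h : a <= a' -> b' <= b -> ac_on a b h -> ac_on a' b' h.
Proof.
move=> aa bb ach e e0; have [d d0 dP] := ach e e0; exists d => // k l r lr.
by apply: dP => i; have [? ? ?] := lr i; split=> //; [exact: le_trans aa _|exact: le_trans bb].
Qed.

Lemma ac_onN a b h : ac_on a b h -> ac_on a b (fun t => - h t).
Proof.
move=> ach e e0; have [d d0 dP] := ach e e0; exists d => // k l r lr tr lrd.
by under eq_bigr do rewrite -opprD normrN; exact: dP.
Qed.

(** Near [t] the derivative is almost everywhere within [e] of [G t], so [ac_growth] for [h] and for
    [- h] encloses the increments between the slopes [G t - e] and [G t + e]. *)
Lemma ac_derive_everywhere h G t : (forall T, 0 <= T -> ac_on 0 T h) ->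
  {ae @lebesgue_measure R, forall s : R, 0 <= s -> is_derive s 1 h (G s)} ->
  0 < t ->
  (forall e : R, 0 < e -> exists2 d : R, 0 < d &
     forall s, 0 <= s -> `|s - t| < d -> `|G s - G t| < e) ->
  is_derive t 1 h (G t).
Proof.
move=> ach hG t0 Gt; apply/is_deriveP => e e0.
have [d d0 dP] := Gt e e0.
have key a b : 0 <= a -> a <= b -> t - d < a -> b < t + d ->
    `|h b - h a - G t * (b - a)| <= e * (b - a).
  move=> a0 ab da bd; have acab := ac_onS a0 (lexx b) (ach b (le_trans a0 ab)).
  have sP s : a < s < b -> `|G s - G t| < e.
    by move=> /andP[as_ sb]; apply: dP; [lra|rewrite ltr_norml; lra].
  have up : h b - h a <= (G t + e) * (b - a).
    apply: (ac_growth ab acab); apply: (ae_imp hG) => s hs sab.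
    have /andP[as_ _] := sab.
    apply: is_derive_slope (hs _) _; first by lra.
    by have := sP s sab; rewrite ltr_norml => /andP[_]; lra.
  have down : - h b - - h a <= (- G t + e) * (b - a).
    apply: (ac_growth ab (ac_onN acab)); apply: (ae_imp hG) => s hs sab.
    have /andP[as_ _] := sab.
    have hs' : is_derive s 1 (fun t => - h t) (- G s).
      by apply: is_deriveN; apply: hs; lra.
    apply: is_derive_slope hs' _.
    by have := sP s sab; rewrite ltr_norml => /andP[+ _]; lra.
  by rewrite ler_norml; move: up down; lra.
exists (Num.min d t) => [|s]; first by rewrite lt_min d0.
rewrite lt_min !ltr_norml => /andP[/andP[h1 h2] /andP[h3 h4]].
have [st|/ltW ts] := leP s t.
  have s0 : 0 <= s by lra.
  have := key s t s0 st; rewrite (ler0_norm (_ : s - t <= 0)) ?subr_le0// opprB.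
  have -> : h t - h s - G t * (t - s) = - (h s - h t - G t * (s - t)) by ring.
  by rewrite normrN; apply; lra.
have := key t s (ltW t0) ts; rewrite (ger0_norm (_ : 0 <= s - t)) ?subr_ge0//.
by apply; lra.
Qed.

End ScalarDerivative.

(** * Vector-valued curves and the distance between them *)

Section VectorDerivative.
Context {R : realType} {N : nat}.
Implicit Types (z w : R -> 'rV[R]_N) (u v : 'rV[R]_N) (t a b T : R).

Lemma is_derive_coordP z u t : is_derive t 1 z u <->
  forall i, is_derive t 1 (fun s => z s ord0 i) (u ord0 i).
Proof.
split=> [zu i|zu].
  have dz : derivable z t 1 by exact: ex_derive.
  split; first exact: (derivable_mxP z t 1).1.
  by rewrite -(derive_val (is_derive := zu)) derive_mx// mxE.
have dz : derivable z t 1.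
  by apply/derivable_mxP => i j; rewrite ord1; exact: (ex_derive (is_derive := zu j)).
split=> //; rewrite derive_mx//; apply/rowP => j; rewrite mxE.
exact: (derive_val (is_derive := zu j)).
Qed.

Lemma is_derive_sum_fun (h : 'I_N -> R -> R) (c : 'I_N -> R) t :
  (forall i, is_derive t 1 (h i) (c i)) ->
  is_derive t 1 (fun s => \sum_i h i s) (\sum_i c i).
Proof.
move=> hc; have -> : (fun s => \sum_i h i s) = \sum_i h i.
  by apply/funext => s; rewrite fct_sumE.
by apply: is_derive_sum.
Qed.

Lemma is_derive_dotp z u v t : is_derive t 1 z u ->
  is_derive t 1 (fun s => dotp v (z s)) (dotp v u).
Proof.
move=> /is_derive_coordP zu; by apply: is_derive_sum_fun => i; apply: is_deriveZ.
Qed.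

Lemma is_derive_edist_sqr z w u v t : is_derive t 1 z u -> is_derive t 1 w v ->
  is_derive t 1 (fun s => edist (z s) (w s) ^+ 2) (2 * dotp (z t - w t) (u - v)).
Proof.
move=> /is_derive_coordP zu /is_derive_coordP wv.
have -> : (fun s => edist (z s) (w s) ^+ 2) =
    (fun s => \sum_i (z s ord0 i - w s ord0 i) * (z s ord0 i - w s ord0 i)).
  by apply/funext => s; rewrite edist_sqr; apply: eq_bigr => i _; rewrite !mxE.
rewrite mulr_sumr; apply: is_derive_sum_fun => i.
have d : is_derive t 1 (fun s => z s ord0 i - w s ord0 i) (u ord0 i - v ord0 i).
  exact: is_deriveB.
apply: is_derive_eq (is_deriveM d d) _.
by rewrite !mxE /GRing.scale /=; ring.
Qed.

Lemma ac_uniform a b z : absolutely_continuous_on a b z -> forall e : R, 0 < e ->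
  exists2 d : R, 0 < d & forall s t, a <= s -> s <= t -> t <= b -> t - s < d ->
    edist (z t) (z s) < e.
Proof.
move=> acz e e0; have [d d0 dP] := acz e e0; exists d => // s t as_ st tb td.
have := dP 1%N (fun=> s) (fun=> t); rewrite !big_ord1; apply=> //.
by move=> i j _ _ _; rewrite !ord1.
Qed.

Lemma ac_on_dominated a b z w (h : R -> R) (M : R) : 0 < M ->
  absolutely_continuous_on a b z -> absolutely_continuous_on a b w ->
  (forall s t, a <= s -> s <= t -> t <= b ->
     `|h t - h s| <= M * (edist (z t) (z s) + edist (w t) (w s))) ->
  ac_on a b h.
Proof.
move=> M0 acz acw hM e e0.
have e2 : 0 < e / M / 2 by rewrite !divr_gt0.
have [dz dz0 dzP] := acz _ e2; have [dw dw0 dwP] := acw _ e2.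
exists (Num.min dz dw) => [|k l r lr tr]; first by rewrite lt_min dz0.
rewrite lt_min => /andP[/(dzP _ _ _ lr tr) hz /(dwP _ _ _ lr tr) hw].
apply: (@le_lt_trans _ _ (\sum_i M * (edist (z (r i)) (z (l i)) + edist (w (r i)) (w (l i))))).
  by apply: ler_sum => i _; have [? ? ?] := lr i; exact: hM.
rewrite -mulr_sumr big_split /= -ltr_pdivlMl// mulrC [ltRHS]splitr.
exact: ltrD.
Qed.

(** Increments of the distance are bounded by those of the two curves, and squaring is Lipschitz on
    the bounded range of the distance. *)
Lemma ac_edist_sqr a b z w : a <= b ->
  absolutely_continuous_on a b z -> absolutely_continuous_on a b w ->
  ac_on a b (fun t => edist (z t) (w t) ^+ 2).
Proof.
move=> ab acz acw; pose D t := edist (z t) (w t).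
have DB s t : `|D t - D s| <= edist (z t) (z s) + edist (w t) (w s).
  have h1 := edist_triangle (z s) (z t) (w t).
  have h2 := edist_triangle (w s) (z s) (w t).
  have h3 := edist_triangle (z t) (z s) (w s).
  have h4 := edist_triangle (w t) (z t) (w s).
  move: h2 h3; rewrite (edistC (w s)) (edistC (z s) (z t)) => h2 h3.
  by rewrite ler_norml /D; lra.
have Dc : {within `[a, b], continuous D}.
  apply/subspace_continuousP => t; rewrite /= in_itv /= => /andP[at_ tb].
  apply/cvgrPdist_lt => e e0; have e2 : 0 < e / 2 by rewrite divr_gt0.
  have [dz dz0 dzP] := ac_uniform acz e2; have [dw dw0 dwP] := ac_uniform acw e2.
  have d0 : 0 < Num.min dz dw by rewrite lt_min dz0.
  apply/nbhs_ballP; exists (Num.min dz dw) => //= s.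
  rewrite -ball_normE /= lt_min !ltr_norml in_itv /=.
  move=> /andP[/andP[h1 h2] /andP[h3 h4]] /andP[as_ sb].
  rewrite -ltr_norml /from_subspace; apply: le_lt_trans (DB _ _) _; rewrite [ltRHS]splitr.
  have [st|/ltW ts] := leP s t; first by rewrite ltrD// ?dzP ?dwP.
  rewrite (edistC (z t)) (edistC (w t)) ltrD//.
    by apply: dzP => //; lra.
  by apply: dwP => //; lra.
have [c _ cP] := EVT_max ab Dc.
have M0 : 0 < 2 * D c + 1 by rewrite ltr_wpDl// mulr_ge0// edist_ge0.
apply: (ac_on_dominated M0 acz acw) => s t as_ st tb.
have Ds : D s <= D c by apply: cP; rewrite in_itv /= as_ (le_trans st).
have Dt : D t <= D c by apply: cP; rewrite in_itv /= tb (le_trans as_).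
have D0 r : 0 <= D r by exact: edist_ge0.
rewrite -/(D t) -/(D s) subr_sqr normrM mulrC.
apply: ler_pM => //; rewrite ger0_norm ?addr_ge0//.
by have := D0 c; lra.
Qed.

(** The squared distance has a nonpositive derivative almost everywhere, hence slopes below every
    positive constant. *)
Lemma edist_decreasing a b z w : a <= b ->
  absolutely_continuous_on a b z -> absolutely_continuous_on a b w ->
  {ae @lebesgue_measure R, forall t : R, a < t < b -> exists u v,
    [/\ is_derive t 1 z u, is_derive t 1 w v & dotp (z t - w t) (u - v) <= 0]} ->
  edist (z b) (w b) <= edist (z a) (w a).
Proof.
move=> ab acz acw zw.
rewrite -(@ler_pXn2r _ 2)// ?nnegrE ?edist_ge0//; apply: ler_eps => e e0.
(* With this slope the total growth is at most [e]; the summand 1 keeps the denominator positive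
   when [a = b]. *)
have c0 : 0 < e / (b - a + 1) by rewrite divr_gt0// ltr_wpDl// subr_ge0.
have : edist (z b) (w b) ^+ 2 - edist (z a) (w a) ^+ 2 <= e / (b - a + 1) * (b - a).
  apply: (ac_growth ab (ac_edist_sqr ab acz acw)).
  apply: (ae_imp zw) => t zwt /zwt[u [v [zu wv uv]]].
  apply: is_derive_slope (is_derive_edist_sqr zu wv) _.
  by apply: le_lt_trans c0; rewrite pmulr_rle0.
have : e / (b - a + 1) * (b - a) <= e.
  rewrite mulrAC ler_pdivrMr ?ler_pM2l//; first lra.
  by rewrite ltr_wpDl// subr_ge0.
lra.
Qed.

Lemma lipschitz_ac a b (M : R) z : 0 < M ->
  (forall s t, a <= s -> s <= t -> t <= b -> edist (z t) (z s) <= M * (t - s)) ->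
  absolutely_continuous_on a b z.
Proof.
move=> M0 zM e e0; exists (e / M) => [|k l r lr _]; first by rewrite divr_gt0.
rewrite ltr_pdivlMr// mulrC => h; apply: le_lt_trans h; rewrite mulr_sumr.
by apply: ler_sum => i _; have [? ? ?] := lr i; exact: zM.
Qed.

(** The velocity is bounded on the compact interval, so the mean value theorem in each coordinate
    gives a Lipschitz constant. *)
Lemma C1_curve_ac a b z (G : R -> 'rV[R]_N) : a <= b ->
  (forall t, is_derive t 1 z (G t)) ->
  (forall t (e : R), 0 < e -> exists2 d : R, 0 < d & forall s,
     `|s - t| < d -> edist (G s) (G t) < e) ->
  absolutely_continuous_on a b z.
Proof.
move=> ab zG Gc.
have Ec : {within `[a, b], continuous (fun t => enorm (G t))}.
  apply: continuous_subspaceT => t; apply/cvgrPdist_lt => e e0.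
  have [d d0 dP] := Gc t e e0; apply/nbhs_ballP; exists d => //= s.
  rewrite /= distrC => /dP; apply: le_lt_trans.
  have h1 := enormD (G s - G t) (G t); have h2 := enormD (G t - G s) (G s).
  move: h1 h2; rewrite !subrK -!edistE (edistC (G t)).
  by rewrite ler_norml; lra.
have [c _ cP] := EVT_max ab Ec; pose M := N%:R * enorm (G c) + 1.
have M0 : 0 < M by rewrite ltr_wpDl// mulr_ge0// enorm_ge0.
apply: (lipschitz_ac M0) => s t as_ st tb.
rewrite edistE; apply: le_trans (enorm_le_sum _) _.
apply: (@le_trans _ _ (\sum_(i < N) enorm (G c) * (t - s))).
  apply: ler_sum => i _; rewrite !mxE.
  have := @mean_value_approx _ (fun r => z r ord0 i) (fun r => G r ord0 i) s t 0 (enorm (G c)) st.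
  rewrite mul0r subr0; apply => r /andP[sr rt]; split.
    by move: (zG r) => /is_derive_coordP.
  rewrite subr0; apply: le_trans (coord_le_enorm _ _) _.
  by apply: cP; rewrite in_itv /= (le_trans as_)//= (le_trans rt).
have -> : \sum_(i < N) enorm (G c) * (t - s) = N%:R * (enorm (G c) * (t - s)).
  by rewrite sumr_const card_ord mulr_natl.
by rewrite mulrA ler_wpM2r ?subr_ge0// /M; lra.
Qed.

End VectorDerivative.

(** * Faces and normal cones *)

Section Faces.
Context {R : realType} {N : nat}.
Implicit Types (K A S F V : set 'rV[R]_N) (p q e n v z w c x : 'rV[R]_N).

Lemma affine_span_line A c x (s : R) : A c -> A x -> affine_span A (c + s *: (c - x)).
Proof.
move=> Ac Ax B [aB AB].
have -> : c + s *: (c - x) = (1 - - s) *: c + - s *: x.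
  by apply/rowP => i; rewrite !mxE; ring.
by apply: aB; exact: AB.
Qed.

Lemma relint_extend A c x : relint A c -> A x ->
  exists2 s : R, 0 < s & A (c + s *: (c - x)).
Proof.
move=> [Ac /nbhs_edistP[e e0 eA]] Ax.
have d0 : 0 < edist c x + 1 by rewrite ltr_wpDl ?edist_ge0.
exists (e / (edist c x + 1)); first by rewrite divr_gt0.
apply: eA; last exact: affine_span_line.
rewrite edistE addrAC subrr add0r enormZ gtr0_norm ?divr_gt0//.
rewrite mulrAC ltr_pdivrMr// ltr_pM2l// -edistE; lra.
Qed.

Lemma exposed_face K n z : cvx K -> normal_cone K z n ->
  is_face K [set w | K w /\ dotp n (w - z) = 0].
Proof.
move=> vK nz; split; [|by move=> w []|].
- apply/convex_set_cvx => t p q t0 t1 [Kp np] [Kq nq]; split; first exact: vK.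
  have -> : t *: p + (1 - t) *: q - z = t *: (p - z) + (1 - t) *: (q - z).
    by apply/rowP => i; rewrite !mxE; ring.
  by rewrite dotpDr !dotpZr np nq !mulr0 addr0.
- move=> p q LK [c [/= cL [Kc nc]]] x Lx; split; first exact: LK.
  (* If [x] were strictly below the supporting hyperplane, extending the segment past [c] would lead
     strictly above it. *)
  have [s s0 /LK/nz] := relint_extend cL Lx.
  apply: contraPeq => nx; apply/negP; rewrite -ltNge.
  have {}nx : dotp n (x - z) < 0 by rewrite lt_neqAle nx nz//; exact: LK.
  have -> : c + s *: (c - x) - z = (c - z) + s *: ((c - z) - (x - z)).
    by apply/rowP => i; rewrite !mxE; ring.
  by rewrite dotpDr dotpZr (dotpBr n (c - z)) nc add0r sub0r mulr_gt0// oppr_gt0.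
Qed.

Lemma relint_segment p q (a : R) : 0 < a -> a < 1 ->
  relint (line_segment p q) (a *: p + (1 - a) *: q).
Proof.
move=> a0 a1; split.
  exists (1 - a); first by rewrite /= in_itv /=; apply/andP; split; lra.
  by rewrite subKr.
(* For [p = q] the segment and its affine span are the same singleton. *)
have [<-|pq] := eqVneq p q.
  apply: filterE => w /(_ [set p]) -> //.
    by exists 0; rewrite ?subr0 ?scale1r ?scale0r ?addr0//= in_itv /= lexx ler01.
  split; first by move=> ? ? t -> ->; rewrite -scalerDl subrK scale1r.
  by move=> _ [t _ <-] /=; rewrite -scalerDl subrK scale1r.
have pq0 : 0 < edist p q.
  by rewrite lt_neqAle edist_ge0 andbT eq_sym; apply: contra pq => /eqP/edist_eq0 ->.
apply/nbhs_edistP; exists (Num.min a (1 - a) * edist p q).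
  by rewrite mulr_gt0// lt_min a0 subr_gt0.
(* The line through [p] and [q] is an affine set containing the segment, so it contains [w]. *)
move=> w wa /(_ [set (1 - t) *: p + t *: q | t in [set: R]])[].
  split; last by move=> _ [t _ <-]; exists t.
  move=> _ _ r [t _ <-] [s _ <-]; exists ((1 - r) * t + r * s) => //.
  by apply/rowP => i; rewrite !mxE; ring.
move=> t _ tw; exists t => //; rewrite /= in_itv /=.
move: wa; rewrite -tw edistE.
have -> : (1 - t) *: p + t *: q - (a *: p + (1 - a) *: q) = (1 - a - t) *: (p - q).
  by apply/rowP => i; rewrite !mxE; ring.
rewrite enormZ -edistE ltr_pM2r// lt_min !ltr_norml => /andP[/andP[h1 h2] /andP[h3 h4]].
by apply/andP; split; lra.
Qed.

Lemma face_barycenter K A p q (a : R) : cvx K -> is_face K A -> K p -> K q ->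
  0 < a -> a < 1 -> A (a *: p + (1 - a) *: q) -> A p.
Proof.
move=> vK [_ _ fA] Kp Kq a0 a1 Ac.
have LK : line_segment p q `<=` K.
  move=> _ [t + <-]; rewrite /= in_itv /= => /andP[t0 t1]; rewrite addrC.
  exact: vK.
apply: (fA p q LK); first by exists (a *: p + (1 - a) *: q); split=> //; exact: relint_segment.
by exists 0; rewrite ?subr0 ?scale1r ?scale0r ?addr0//= in_itv /= lexx ler01.
Qed.

(** Each face through [e] contains the segment from [p] to [q], since [e] is in its relative
    interior. *)
Lemma minimal_face_barycenter K S e p q (a : R) : cvx K -> S e -> K p -> K q ->
  0 < a -> a < 1 -> e = a *: p + (1 - a) *: q -> minimal_face K S p.
Proof.
move=> vK Se Kp Kq a0 a1 ee A [fA SA].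
by apply: (face_barycenter vK fA Kp Kq a0 a1); rewrite -ee; exact: SA.
Qed.

Local Notation V K S := (affine_span (minimal_face K S)).

Lemma sub_minimal_face_span K S p : minimal_face K S p -> V K S p.
Proof. by move=> Fp B [_]; apply. Qed.

Lemma sub_minimal_face K S : S `<=` minimal_face K S.
Proof. by move=> e Se A [_]; apply. Qed.

Lemma normal_cone_affine_const K S n p q :
  normal_cone_affine (V K S) n -> V K S p -> V K S q -> dotp n (p - q) = 0.
Proof.
move=> nV Vp Vq; apply/eqP; rewrite eq_le (nV q Vq p Vp) /=.
by rewrite -oppr_le0 -dotpNr opprB; exact: nV p Vp q Vq.
Qed.

(** The face of [K] exposed by [n] contains [S], hence the minimal face; so [dotp n] is constant on
    the affine span. *)
Lemma minimal_face_normal K S n z : cvx K -> normal_cone K z n -> S `<=` K ->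
  (forall e, S e -> dotp n (e - z) = 0) -> normal_cone_affine (V K S) n.
Proof.
move=> vK nz SK nS.
have VH : V K S `<=` [set w | dotp n (w - z) = 0].
  move=> w; apply; split.
    move=> p q t /= np nq.
    have -> : (1 - t) *: p + t *: q - z = (1 - t) *: (p - z) + t *: (q - z).
      by apply/rowP => i; rewrite !mxE; ring.
    by rewrite dotpDr !dotpZr np nq !mulr0 addr0.
  have FH : minimal_face K S `<=` [set w | K w /\ dotp n (w - z) = 0].
    move=> p; apply; split; first exact: exposed_face.
    by move=> e Se; split; [exact: SK|exact: nS].
  by move=> p /FH[].
move=> p /VH pz q /VH qz.
have -> : q - p = (q - z) - (p - z) by apply/rowP => i; rewrite !mxE; ring.
by rewrite dotpBr pz qz subrr.
Qed.

Lemma normal_cone_eclosed K z : eclosed (normal_cone K z).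
Proof.
move=> n nP w Kw; apply: ler_eps => e e0; rewrite add0r.
have d0 : 0 < edist w z + 1 by rewrite ltr_wpDl ?edist_ge0.
have [v vz vn] := nP _ (divr_gt0 e0 d0).
have -> : n = v - (v - n) by apply/rowP => i; rewrite !mxE; ring.
rewrite dotpBl; have := vz w Kw.
have := le_trans (ler_norm _) (ler_dotp_enorm (v - n) (- (w - z))).
rewrite dotpNr enormN -!edistE.
have : edist v n * edist w z <= e.
  rewrite -[leRHS](divfK (lt0r_neq0 d0)); apply: ler_pM; rewrite ?edist_ge0//; first exact: ltW.
  lra.
lra.
Qed.

Lemma normal_cone_cvx K z : cvx (normal_cone K z).
Proof.
move=> t p q t0 t1 pz qz w Kw; rewrite dotpDl !dotpZl.
have t1' : 0 <= 1 - t by rewrite subr_ge0.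
have := mulr_ge0_le0 t0 (pz w Kw); have := mulr_ge0_le0 t1' (qz w Kw); lra.
Qed.

Lemma normal_cone0 K z : normal_cone K z 0.
Proof. by move=> w _; rewrite dotp0l. Qed.

Lemma normal_cone_affine_eclosed V : eclosed (normal_cone_affine V).
Proof.
move=> n nP z Vz; apply: normal_cone_eclosed => e /nP[v vV vn].
by exists v => //; exact: vV.
Qed.

Lemma normal_cone_affine_cvx V : cvx (normal_cone_affine V).
Proof.
by move=> t p q t0 t1 pV qV z Vz; apply: normal_cone_cvx => //; [exact: pV|exact: qV].
Qed.

Lemma normal_cone_affine0 V : normal_cone_affine V 0.
Proof. by move=> z _; exact: normal_cone0. Qed.

End Faces.

(** * Translation and locality of derivatives of curves *)

Section CurveFacts.
Context {R : realType} {N : nat}.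

Lemma is_derive_shift (z : R -> 'rV[R]_N) u (t s : R) :
  is_derive (t + s) 1 z u -> is_derive t 1 (fun r => z (r + s)) u.
Proof.
move=> /is_derive_coordP zu; apply/is_derive_coordP => i.
apply/is_deriveP => e e0; have /is_deriveP/(_ e e0)[d d0 dP] := zu i.
exists d => // r rd; have := dP (r + s).
have -> : r + s - (t + s) = r - t by ring.
exact.
Qed.

Lemma is_derive_near_eq (z w : R -> 'rV[R]_N) u (t d : R) : 0 < d ->
  (forall s, `|s - t| < d -> w s = z s) -> is_derive t 1 z u -> is_derive t 1 w u.
Proof.
move=> d0 wz; apply: near_eq_is_derive.
by exists d => //= s; rewrite /ball_ /= distrC => /wz.
Qed.

Lemma is_derive_continuous (z : R -> 'rV[R]_N) u (t e : R) :
  is_derive t 1 z u -> 0 < e ->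
  exists2 d : R, 0 < d & forall s, `|s - t| < d -> edist (z s) (z t) < e.
Proof.
move=> zu e0; have zc : {for t, continuous z}.
  by apply: differentiable_continuous; apply/derivable1_diffP; exact: ex_derive.
have : nbhs t (z @^-1` [set w | edist w (z t) < e]).
  by apply: zc; apply/nbhs_edistP; exists e.
move=> /nbhs_ballP[d /= d0 dP]; exists d => // s sd; apply: dP.
by rewrite -ball_normE /= distrC.
Qed.

End CurveFacts.

(** * Projected monotone dynamics *)

Lemma ae_exists (R : realType) (a b : R) (P : R -> Prop) : a < b ->
  {ae @lebesgue_measure R, forall t, P t} -> exists2 t, a < t < b & P t.
Proof.
move=> ab [A [mA A0 PA]]; apply: contrapT => noP.
have sub : `]a, b[%classic `<=` A.
  move=> t /=; rewrite in_itv /= => tab; apply: PA => Pt; apply: noP.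
  by exists t.
have : (@lebesgue_measure R `]a, b[%classic <= lebesgue_measure A)%E.
  by apply: le_measure; rewrite ?inE//; exact: measurable_itv.
have -> : @lebesgue_measure R `]a, b[%classic = (b - a)%:E.
  by apply: etrans (lebesgue_measure_itv _) _; rewrite /= lte_fin ab EFinB.
by rewrite A0 lee_fin subr_le0 leNgt ab.
Qed.

Section ProjectedMonotoneFlow.
Context {R : realType} {N : nat} {K : set 'rV[R]_N} {f : 'rV[R]_N -> 'rV[R]_N}
  {Phi : R -> 'rV[R]_N -> 'rV[R]_N}.
Context (clK : eclosed K) (vK : cvx K).
Context (monotone_f : forall z w, K z -> K w -> dotp (f z - f w) (z - w) <= 0).
Context (continuous_f : forall z (d : R), K z -> 0 < d ->
  exists2 h : R, 0 < h & forall w, edist w z < h -> edist (f w) (f z) < d).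
Local Notation pf := (fun z => f z - eproj (normal_cone K z) (f z)).
Context (semi_flow_Phi : semi_flow K Phi).
Context (Phi_solution : forall z, K z -> caratheodory_solution pf (fun t => Phi t z)).
Implicit Types (z w e o p q u v n : 'rV[R]_N) (t s T : R).

Let PhiK t z : 0 <= t -> K z -> K (Phi t z).
Proof. by case: semi_flow_Phi => + _ _ _; apply. Qed.

Let Phi0 z : K z -> Phi 0 z = z.
Proof. by case: semi_flow_Phi => _ + _ _; apply. Qed.

Definition equilibria : set 'rV[R]_N := [set e | K e /\ normal_cone K e (f e)].

(** An arbitrary normal vector covers the projected velocity, rest at an equilibrium and, with
    [n = 0], classical solutions staying in [K]. *)
Definition velocity z u := exists2 n, normal_cone K z n & u = f z - n.

Lemma velocity_monotone z w u v : K z -> K w -> velocity z u -> velocity w v ->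
  dotp (z - w) (u - v) <= 0.
Proof.
move=> Kz Kw [n nz ->] [k kw ->].
have -> : f z - n - (f w - k) = (f z - f w) - n + k.
  by apply/rowP => i; rewrite !mxE; ring.
have := monotone_f Kz Kw; have := nz w Kw; have := kw z Kz.
have -> : dotp (z - w) (f z - f w - n + k) =
    dotp (f z - f w) (z - w) - dotp n (z - w) + dotp k (z - w).
  by rewrite dotpC dotpDl (dotpBl _ n).
rewrite -[w - z]opprB dotpNr; lra.
Qed.

Lemma projected_velocity z : velocity z (pf z).
Proof.
exists (eproj (normal_cone K z) (f z)) => //.
apply: (eprojP _ _ _ _).1; [exact: normal_cone_eclosed| |exact: normal_cone_cvx].
by exists 0; exact: normal_cone0.
Qed.

Lemma equilibrium_velocity e : equilibria e -> velocity e 0.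
Proof. by move=> [_ eN]; exists (f e) => //; rewrite subrr. Qed.

(** Stated for general curves, to compare an orbit with another orbit, with a constant equilibrium
    and with a classical solution. *)
Lemma trajectory_contraction T (z w : R -> 'rV[R]_N) : 0 <= T ->
  (forall t, 0 <= t -> K (z t)) -> (forall t, 0 <= t -> K (w t)) ->
  absolutely_continuous_on 0 T z -> absolutely_continuous_on 0 T w ->
  {ae @lebesgue_measure R, forall t : R, 0 <= t ->
    exists2 u, is_derive t 1 z u & velocity (z t) u} ->
  {ae @lebesgue_measure R, forall t : R, 0 <= t ->
    exists2 u, is_derive t 1 w u & velocity (w t) u} ->
  edist (z T) (w T) <= edist (z 0) (w 0).
Proof.
move=> T0 Kz Kw acz acw [A [mA A0 PA]] [B [mB B0 PB]].
apply: (edist_decreasing T0 acz acw); exists (A `|` B); split.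
- exact: measurableU.
- by apply: null_set_setU.
- move=> t nt; apply: contrapT => /not_orP[nA nB]; apply: nt => /= /andP[/ltW t0 _].
  have [u zu uz] : exists2 u, is_derive t 1 z u & velocity (z t) u.
    by apply: contrapT => nz; apply/nA/PA => /= /(_ t0).
  have [v wv vw] : exists2 u, is_derive t 1 w u & velocity (w t) u.
    by apply: contrapT => nw; apply/nB/PB => /= /(_ t0).
  by exists u, v; split=> //; apply: velocity_monotone => //; [exact: Kz|exact: Kw].
Qed.

Lemma Phi_velocity z : K z -> {ae @lebesgue_measure R, forall t : R, 0 <= t ->
    exists2 u, is_derive t 1 (fun s => Phi s z) u & velocity (Phi t z) u}.
Proof.
move=> Kz; have [_ zae] := Phi_solution Kz; apply: (ae_imp zae) => t h t0.
by exists (pf (Phi t z)); [exact: h|exact: projected_velocity].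
Qed.

Lemma Phi_nonexpansive t z w : 0 <= t -> K z -> K w ->
  edist (Phi t z) (Phi t w) <= edist z w.
Proof.
move=> t0 Kz Kw; rewrite -{2}(Phi0 Kz) -{2}(Phi0 Kw).
apply: (trajectory_contraction (z := fun t => Phi t z) (w := fun t => Phi t w) t0).
- by move=> s s0; exact: PhiK.
- by move=> s s0; exact: PhiK.
- exact: (Phi_solution Kz).1.
- exact: (Phi_solution Kw).1.
- exact: Phi_velocity.
- exact: Phi_velocity.
Qed.

Lemma equilibrium_fixed e t : equilibria e -> 0 <= t -> Phi t e = e.
Proof.
move=> Se t0; have Ke := Se.1; apply: edist_eq0; apply/eqP.
rewrite eq_le edist_ge0 andbT.
suff : edist (Phi t e) e <= edist (Phi 0 e) e by rewrite Phi0// edistxx.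
apply: (trajectory_contraction (z := fun t => Phi t e) (w := fun=> e) t0) => //.
- by move=> s s0; exact: PhiK.
- exact: (Phi_solution Ke).1.
- apply: (lipschitz_ac ltr01) => s r _ sr _.
  by rewrite edistxx mul1r subr_ge0.
- exact: Phi_velocity.
- exists set0; split=> // s; apply => _; exists 0; last exact: equilibrium_velocity.
  exact: is_derive_cst.
Qed.

Lemma Phi_nonexpansive_semiflow o : equilibria o -> nonexpansive_semiflow K Phi o.
Proof.
move=> So; have [_ _ PhiD _] := semi_flow_Phi; split=> //.
- exact: Phi_nonexpansive.
- move=> z T d Kz d0.
  have T0 : 0 <= Num.max 0 T by rewrite le_max lexx.
  have [h h0 hP] := ac_uniform ((Phi_solution Kz).1 _ T0) d0.
  by exists h => // t s s0 st tT; apply: hP => //; rewrite le_max tT orbT.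
- exact: So.1.
- by move=> t t0; exact: equilibrium_fixed.
Qed.

(** The constant orbit has derivative 0 at some time where the equation holds, which puts [f e] in
    the normal cone. *)
Lemma fixed_equilibrium e : K e -> (forall t, 0 <= t -> Phi t e = e) -> equilibria e.
Proof.
move=> Ke eF; split=> //.
have [t /andP[t0 _] [|u eu]] := ae_exists ltr01 (Phi_velocity Ke); first exact: ltW.
have -> : u = 0.
  apply/rowP => i; move/is_derive_coordP/(_ i): eu; rewrite mxE.
  by apply: is_derive_const_on => // s s0; rewrite !eF// ltW.
by rewrite eF ?ltW// => -[n ne /esym/subr0_eq ->].
Qed.

(** Uniqueness by contraction: both curves start at [z s]. *)
Lemma classical_trajectory (z : R -> 'rV[R]_N) t s : 0 <= t ->
  (forall r, K (z r)) -> (forall r : R, is_derive r 1 z (f (z r))) ->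
  Phi t (z s) = z (t + s).
Proof.
move=> t0 Kz zf; apply: edist_eq0; apply/eqP.
rewrite eq_le edist_ge0 andbT.
suff : edist (Phi t (z s)) (z (t + s)) <= edist (Phi 0 (z s)) (z (0 + s)).
  by rewrite Phi0// add0r edistxx.
have zs (r : R) : is_derive r 1 (fun r : R => z (r + s)) (f (z (r + s))).
  by apply: is_derive_shift.
apply: (trajectory_contraction (z := fun t => Phi t (z s)) (w := fun r => z (r + s)) t0) => //.
- by move=> r r0; exact: PhiK.
- exact: (Phi_solution (Kz s)).1.
- apply: (C1_curve_ac t0 zs) => r e e0.
  have [h h0 hP] := continuous_f (Kz (r + s)) e0.
  have [d d0 dP] := is_derive_continuous (zs r) h0.
  by exists d => // r' /dP/hP.
- exact: Phi_velocity.
- exists set0; split=> // r; apply => _; exists (f (z (r + s))); first exact: zs.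
  by exists 0; [exact: normal_cone0|rewrite subr0].
Qed.

(** * The omega-limit set of the projected flow *)

Context (equilibria_nonempty : equilibria !=set0).
Local Notation Omega := (omega_limit K Phi).
Local Notation V := (affine_span (minimal_face K equilibria)).

Lemma recurrentP z : Omega z <-> recurrent K Phi z.
Proof.
have [c0 Sc0] := equilibria_nonempty.
exact: (omega_limit_recurrent (Phi_nonexpansive_semiflow Sc0)).
Qed.

Lemma equilibrium_recurrent e : equilibria e -> recurrent K Phi e.
Proof.
move=> Se; split; first exact: Se.1.
by move=> d T d0 T0; exists T => //; rewrite equilibrium_fixed// edistxx.
Qed.

(** By [fixed_barycenter], arbitrarily close to [z] there is a point [p] having an equilibrium as a
    proper barycenter with another point of [K]; such a [p] lies in the minimal face. *)
Lemma Omega_orthogonal n z e : normal_cone_affine V n -> Omega z -> equilibria e ->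
  dotp n (z - e) = 0.
Proof.
move=> nV /recurrentP Rz Se; have [c0 Sc0] := equilibria_nonempty.
apply/eqP; rewrite -normr_le0; apply: ler_eps => d d0; rewrite add0r.
have n0 : 0 < enorm n + 1 by rewrite ltr_wpDl ?enorm_ge0.
have [a [p [q [e' [[a0 a1 e'E] Rp Rq pz [Ke' Fe']]]]]] :=
  fixed_barycenter (Phi_nonexpansive_semiflow Sc0) Rz (divr_gt0 d0 n0).
have Fp : minimal_face K equilibria p.
  exact: (minimal_face_barycenter vK (fixed_equilibrium Ke' Fe') Rp.1 Rq.1 a0 a1 e'E).
have pe : dotp n (p - e) = 0.
  apply: (normal_cone_affine_const nV); apply: sub_minimal_face_span => //.
  exact: sub_minimal_face.
have -> : z - e = (p - e) - (p - z) by apply/rowP => i; rewrite !mxE; ring.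
rewrite dotpBr pe sub0r normrN; apply: le_trans (ler_dotp_enorm _ _) _.
rewrite -edistE -[leRHS](divfK (lt0r_neq0 n0)) mulrC.
by apply: ler_pM; rewrite ?edist_ge0 ?enorm_ge0//; lra.
Qed.

(** The cone projected onto does not depend on [z], which makes this field continuous where [f]
    is. *)
Definition face_field z : 'rV[R]_N := f z - eproj (normal_cone_affine V) (f z).
Local Notation G := face_field.

(* Distances to equilibria being constant, the normal component n of the
   velocity is orthogonal to the face spanned by the equilibria. *)
Lemma velocity_on_Omega z t u : Omega z -> 0 < t ->
  is_derive t 1 (fun s => Phi s z) u -> velocity (Phi t z) u -> u = G (Phi t z).
Proof.
move=> Oz t0 zu [n nz uE]; have Rz := (recurrentP z).1 Oz.
have [c0 Sc0] := equilibria_nonempty; have H := Phi_nonexpansive_semiflow Sc0.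
have Kt : K (Phi t z) by apply: PhiK; [exact: ltW|exact: Rz.1].
have dist0 e : equilibria e -> dotp (Phi t z - e) u = 0.
  move=> Se; have : is_derive t 1 (fun s => edist (Phi s z) e ^+ 2) (2 * dotp (Phi t z - e) (u - 0)).
    exact: (is_derive_edist_sqr (w := fun=> e) zu (is_derive_cst _ _ _)).
  rewrite subr0 => /(is_derive_const_on t0) h; apply/eqP.
  suff : 2 * dotp (Phi t z - e) u == 0 by rewrite mulf_eq0 pnatr_eq0.
  apply/eqP/h => s s0; congr (_ ^+ 2).
  rewrite -{1}(equilibrium_fixed Se s0) -{2}(equilibrium_fixed Se (ltW t0)).
  by rewrite !(recurrent_isometry H)// ?ltW//; exact: equilibrium_recurrent.
(* With [x] for [Phi t z], both [dotp (f x) (x - e)] and [- dotp n (x - e)] are nonpositive; by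
   [dist0] they add up to 0, so both vanish. *)
have nV : normal_cone_affine V n.
  apply: (minimal_face_normal vK nz) => [e []//|e Se].
  have h1 := nz e Se.1; have h2 := monotone_f Kt Se.1; have h3 := Se.2 _ Kt.
  have h4 := dist0 e Se; move: h1 h2 h3 h4.
  rewrite uE -[e - Phi t z]opprB dotpNr (dotpC _ (_ - n)).
  by rewrite (dotpBl (f _) n) (dotpBl (f _) (f e)); lra.
rewrite uE /face_field; congr (_ - _); apply/esym/eproj_unique => //.
- exact: normal_cone_affine_eclosed.
- exact: normal_cone_affine_cvx.
- move=> k kV; rewrite -uE dotpC dotpBl.
  (* Vectors of [normal_cone_affine V] have constant product with the orbit, so they are orthogonal
     to [u], and the variational inequality for [n] is an equality. *)
  have orth k' : normal_cone_affine V k' -> dotp k' u = 0.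
    move=> k'V; apply: (@is_derive_const_on _ (fun s => dotp k' (Phi s z)) _ t t0).
      move=> s s0; apply/eqP; rewrite -subr_eq0 -dotpBr; apply/eqP.
      have -> : Phi s z - Phi t z = (Phi s z - c0) - (Phi t z - c0).
        by apply/rowP => i; rewrite !mxE; ring.
      rewrite dotpBr !(Omega_orthogonal k'V) ?subrr//; apply/recurrentP.
        by apply: (recurrent_Phi H) => //; exact: ltW.
      exact: (recurrent_Phi H).
    exact: is_derive_dotp.
  by rewrite !orth// subrr.
Qed.

Lemma G_continuous z (d : R) : K z -> 0 < d ->
  exists2 h : R, 0 < h & forall w, edist w z < h -> edist (G w) (G z) < d.
Proof.
move=> Kz d0; have d2 : 0 < d / 2 by rewrite divr_gt0.
have [h h0 hP] := continuous_f Kz d2; exists h => // w /hP wz.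
have V0 : normal_cone_affine V !=set0 by exists 0; exact: normal_cone_affine0.
have := eproj_nonexpansive (f w) (f z) (@normal_cone_affine_eclosed _ _ V) V0
  (@normal_cone_affine_cvx _ _ V).
set p := eproj _ _; set q := eproj _ _ => pq.
rewrite edistE /face_field -/p -/q.
have -> : f w - p - (f z - q) = (f w - f z) - (p - q).
  by apply/rowP => i; rewrite !mxE; ring.
apply: le_lt_trans (enormD _ _) _; rewrite enormN -!edistE; lra.
Qed.

Lemma Omega_forward_ode z t : Omega z -> 0 < t ->
  is_derive t 1 (fun s => Phi s z) (G (Phi t z)).
Proof.
move=> Oz t0; have Kz := ((recurrentP z).1 Oz).1.
have acz := (Phi_solution Kz).1.
apply/is_derive_coordP => i.
apply: (@ac_derive_everywhere _ (fun s => Phi s z ord0 i) (fun s => G (Phi s z) ord0 i)) => //.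
- move=> T T0; apply: (ac_on_dominated ltr01 (acz T T0) (acz T T0)) => s r s0 sr rT.
  rewrite mul1r; have := coord_le_edist (Phi r z) (Phi s z) i.
  by have := edist_ge0 (Phi r z) (Phi s z); lra.
- have [A [mA A0 PA]] := Phi_velocity Kz.
  (* Time 0 joins the null set because [velocity_on_Omega] concerns positive times. *)
  exists (A `|` [set 0]); split.
  + by apply: measurableU.
  + by apply: null_set_setU => //; exact: lebesgue_measure_set1.
  + move=> s ns; apply: contrapT => /not_orP[nA ns0]; apply: ns => /= s0'.
    have s0 : 0 < s by rewrite lt_neqAle s0' andbT eq_sym; apply/eqP.
    have [u zu uz] : exists2 u, is_derive s 1 (fun s => Phi s z) u & velocity (Phi s z) u.
      by apply: contrapT => nu; apply/nA/PA => /= /(_ s0').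
    have /is_derive_coordP/(_ i) := zu.
    by rewrite (velocity_on_Omega Oz s0 zu uz).
- move=> e e0; have [h h0 hP] := G_continuous (PhiK (ltW t0) Kz) e0.
  have [d d0 dP] := ac_uniform (acz (t + 1) ltac:(lra)) h0.
  exists (Num.min d 1) => [|s s0]; first by rewrite lt_min d0 ltr01.
  rewrite lt_min !ltr_norml => /andP[/andP[h1 h2] /andP[h3 h4]].
  rewrite -ltr_norml; apply: le_lt_trans (coord_le_edist _ _ i) _; apply: hP.
  have [st|/ltW ts] := leP s t; last by apply: dP => //; lra.
  by rewrite edistC; apply: dP => //; lra.
Qed.

Lemma Omega_past z T : 0 <= T -> Omega z -> exists2 w, recurrent K Phi w & Phi T w = z.
Proof.
move=> T0 /recurrentP; have [c0 Sc0] := equilibria_nonempty.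
exact: (recurrent_preimage (Phi_nonexpansive_semiflow Sc0)).
Qed.

Lemma Omega_ode z t : Omega z ->
  is_derive t 1 (fun s => two_sided Omega Phi s z) (G (two_sided Omega Phi t z)).
Proof.
move=> Oz; have [c0 Sc0] := equilibria_nonempty; have H := Phi_nonexpansive_semiflow Sc0.
have T0 : 0 <= `|t| + 1 by rewrite addr_ge0.
have tT : 0 < t + (`|t| + 1) by have := lerNnormlW (lexx `|t|); lra.
have [w Rw wz] := Omega_past T0 Oz.
have Ow : Omega w by exact/recurrentP.
rewrite (two_sidedE H T0 (ltW tT) Rw wz).
apply: (@is_derive_near_eq _ _ (fun s => Phi (s + (`|t| + 1)) w) _ _ _ _ tT).
  move=> s; rewrite ltr_norml => /andP[st _].
  by rewrite (two_sidedE H T0 _ Rw wz)//; lra.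
exact: (is_derive_shift (Omega_forward_ode Ow tT)).
Qed.

Lemma Omega_distance z t e : Omega z -> equilibria e ->
  edist (two_sided Omega Phi t z) e = edist z e.
Proof.
move=> Oz Se; have [c0 Sc0] := equilibria_nonempty; have H := Phi_nonexpansive_semiflow Sc0.
have T0 : 0 <= `|t| by [].
have tT : 0 <= t + `|t| by have := lerNnormlW (lexx `|t|); lra.
have [w Rw wz] := Omega_past T0 Oz; have Re := equilibrium_recurrent Se.
rewrite (two_sidedE H T0 tT Rw wz) -{1}(equilibrium_fixed Se tT).
rewrite (recurrent_isometry H tT Rw Re) -wz -{2}(equilibrium_fixed Se T0).
by rewrite (recurrent_isometry H T0 Rw Re).
Qed.

Lemma Omega_stable z t : Omega z -> Omega (two_sided Omega Phi t z).
Proof.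
have [c0 Sc0] := equilibria_nonempty; move=> Oz.
by have [+ _ _ _] := two_sided_flow (Phi_nonexpansive_semiflow Sc0); apply.
Qed.

(** An interior [e] is the midpoint of [e + c n] and [e - c n] in [K], so [e + c n] is in the
    minimal face and [n] is orthogonal to itself: the cone reduces to 0. *)
Lemma Omega_interior z e (d : R) : equilibria e -> 0 < d ->
  (forall w, edist w e < d -> K w) -> G z = f z.
Proof.
move=> Se d0 eK; rewrite /face_field.
have N0 n : normal_cone_affine V n -> n = 0.
  move=> nV; have n0 : 0 < enorm n + 1 by rewrite ltr_wpDl ?enorm_ge0.
  pose c := d / (enorm n + 1).
  have cgt0 : 0 < c by rewrite divr_gt0.
  have cn : enorm (c *: n) < d.
    by rewrite enormZ gtr0_norm// /c mulrAC ltr_pdivrMr// ltr_pM2l//; lra.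
  have Kp : K (e + c *: n) by apply: eK; rewrite edistE addrAC subrr add0r.
  have Kq : K (e - c *: n) by apply: eK; rewrite edistE addrAC subrr add0r enormN.
  have h0 : 0 < 2^-1 :> R by rewrite invr_gt0.
  have h1 : 2^-1 < 1 :> R by rewrite invf_lt1// ltr1n.
  have eE : e = 2^-1 *: (e + c *: n) + (1 - 2^-1) *: (e - c *: n).
    by apply/rowP => i; rewrite !mxE; field.
  have Fp := minimal_face_barycenter vK Se Kp Kq h0 h1 eE.
  have : dotp n (e + c *: n - e) = 0.
    apply: (normal_cone_affine_const nV); apply: sub_minimal_face_span => //.
    exact: sub_minimal_face.
  rewrite addrAC subrr add0r dotpZr => /eqP; rewrite mulf_eq0 gt_eqF//= => /eqP.
  exact: dotp_eq0.
rewrite [X in _ - X]N0 ?subr0//.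
apply: (eprojP _ _ _ _).1; [exact: normal_cone_affine_eclosed| |exact: normal_cone_affine_cvx].
by exists 0; exact: normal_cone_affine0.
Qed.

(* A bounded backward trajectory accumulates at a point, of whose omega-limit
   set the trajectory is a part. *)
Lemma classical_trajectory_Omega (z : R -> 'rV[R]_N) c (M : R) t :
  (forall r, K (z r)) -> (forall r : R, is_derive r 1 z (f (z r))) ->
  (forall r, edist (z r) c <= M) -> Omega (z t).
Proof.
move=> Kz zf zM; have [c0 Sc0] := equilibria_nonempty.
have H := Phi_nonexpansive_semiflow Sc0.
have [p pP] := @bolzano_weierstrass _ _ (fun k => z (- k%:R)) c M (fun k => zM _).
have Kp : K p by apply: clK => d /pP/(_ 0%N)[k _ kp]; exists (z (- k%:R)).
apply/recurrentP; apply: (omega_point_recurrent H Kp) => d T d0 T0.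
(* From this index on, the time [t + k] elapsed between passing near [p] and reaching [z t] is at
   least [T]. *)
have [k Tk kp] := pP d d0 (Num.truncn (T + `|t|)).+1.
have {}Tk : T + `|t| <= k%:R.
  by apply/ltW/(lt_le_trans (truncnS_gt _)); rewrite ler_nat.
have sT : T <= t + k%:R by have := lerNnormlW (lexx `|t|); lra.
exists (t + k%:R) => //.
have -> : z t = Phi (t + k%:R) (z (- k%:R)).
  by rewrite classical_trajectory ?addrK// (le_trans T0).
apply: le_lt_trans kp; rewrite edistC; apply: Phi_nonexpansive => //.
exact: le_trans sT.
Qed.

End ProjectedMonotoneFlow.

Arguments equilibria {R N} K f.
Arguments face_field {R N} K f z.

(** * Application to the subgradient method *)

Lemma prod_eclosed (R : realType) (n m : nat) (Kx : set 'rV[R]_n) (Ky : set 'rV[R]_m) :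
  eclosed Kx -> eclosed Ky -> eclosed (prod_set Kx Ky).
Proof.
have le (z w : 'rV[R]_(n + m)) : edist (lsubmx z) (lsubmx w) <= edist z w /\
    edist (rsubmx z) (rsubmx w) <= edist z w.
  rewrite !edistE -!linearB /= -{2 4}(hsubmxK (z - w)) /enorm dotp_row_mx.
  by split; apply: ler_wsqrtr; rewrite (lerDl, lerDr) dotp_ge0.
move=> cx cy z zP; split.
  apply: cx => d /zP[w [wx _] wz]; exists (lsubmx w) => //.
  by apply: le_lt_trans wz; have [] := le w z.
apply: cy => d /zP[w [_ wy] wz]; exists (rsubmx w) => //.
by apply: le_lt_trans wz; have [] := le w z.
Qed.

(* Dx x Dy is the domain of definition of phi; Dx = Kx, Dy = Ky is allowed. *)
Theorem theorem25 (R : realType) (n m : nat)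
    (Dx Kx : set 'rV[R]_n) (Dy Ky : set 'rV[R]_m)
    (phi : 'rV[R]_n -> 'rV[R]_m -> R)
    (Phi : R -> 'rV[R]_(n + m) -> 'rV[R]_(n + m))
    (K := prod_set Kx Ky) (D := prod_set Dx Dy)
    (f := saddle_field phi) (Omega := omega_limit K Phi) :
  convex_set Dx -> convex_set Dy -> Kx `<=` Dx -> Ky `<=` Dy ->
  concave_convex Dx Dy phi ->
  closed Kx -> convex_set Kx -> closed Ky -> convex_set Ky ->
  C2_on K (fun z => phi (lsubmx z) (rsubmx z)) ->
  saddle_points K phi !=set0 ->
  subgradient_method K phi Phi ->
  [/\ convex_set Omega,
      defines_flow_of_isometries Omega Phi,
      (let V := affine_span (minimal_face K (saddle_points K phi)) in
       forall z0, Omega z0 ->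
         let z := fun t : R => two_sided Omega Phi t z0 in
         forall t : R,
           is_derive t 1 z
             (f (z t) - eproj (normal_cone_affine V) (f (z t)))) &
      saddle_points D phi `&` interior K !=set0 ->
      Omega = \bigcup_(z in isometric_solutions f (saddle_points D phi) `&`
                            [set z | range z `<=` K]) range z].
Proof.
move=> /convex_set_cvx vDx /convex_set_cvx vDy KDx KDy phiD clKx /convex_set_cvx vKx
  clKy /convex_set_cvx vKy phiC2 saddle_nonempty [semi_flow_Phi Phi_sol].
have clK : eclosed K by apply: prod_eclosed; exact: closed_eclosed.
have vK : cvx K by exact: prod_cvx.
have C1g : forall z, K z -> C1_at (fun z => phi (lsubmx z) (rsubmx z)) z.
  exact: C2_on_C1.
have mono z w : K z -> K w -> dotp (f z - f w) (z - w) <= 0.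
  exact: (saddle_field_monotone phiD KDx KDy C1g).
have cont z (d : R) : K z -> 0 < d ->
    exists2 h : R, 0 < h & forall w, edist w z < h -> edist (f w) (f z) < d.
  exact: (saddle_field_continuous C1g).
have SE : saddle_points K phi = equilibria K f.
  by apply/seteqP; split=> e /(saddle_point_normal phiD KDx KDy vKx vKy C1g).
have S0 : equilibria K f !=set0 by rewrite -SE.
have [c0 Sc0] := S0.
have H := Phi_nonexpansive_semiflow clK vK mono semi_flow_Phi Phi_sol Sc0.
have ode z0 (t : R) := @Omega_ode _ _ _ _ _ clK vK mono cont semi_flow_Phi Phi_sol S0 z0 t.
have KD : K `<=` D by move=> z [zx zy]; split; [exact: KDx|exact: KDy].
split.
- exact: (omega_limit_convex H).
- exact: (nonexpansive_flow_of_isometries H).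
- by move=> V z0 Oz0 z t; rewrite /V SE; exact: ode.
move=> [e [De /nbhs_edistP[d d0 eK]]].
have Ke : K e by apply: eK; rewrite edistxx.
(* A saddle point over [D] that lies in [K] is also a [K]-restricted one, hence an equilibrium. *)
have K_saddle a : saddle_points D phi a -> K a -> equilibria K f a.
  move=> [_ aS] Ka; rewrite -SE; split=> // x y Kx_x Ky_y.
  by apply: aS; exact: KD.
have Se := K_saddle e De Ke.
apply/seteqP; split=> [z0 Oz0|_ [z [[zf zd] zK] [t _ <-]]]; last first.
  (* The constant distance to the saddle point [e] bounds the trajectory. *)
  apply: (classical_trajectory_Omega (c := e) (M := edist (z 0) e) clK vK mono cont
    semi_flow_Phi Phi_sol S0) => [r|r]; first by apply: zK; exists r.
  by rewrite (zd e De r 0).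
pose z t := two_sided Omega Phi t z0.
have Oz (t : R) : Omega (z t).
  exact: (Omega_stable clK vK mono semi_flow_Phi Phi_sol S0).
have zKt t : K (z t).
  by have /(recurrentP clK vK mono semi_flow_Phi Phi_sol S0)[] := Oz t.
have z_dist a : equilibria K f a -> forall t : R, edist (z t) a = edist z0 a.
  by move=> Sa t; exact: (Omega_distance clK vK mono semi_flow_Phi Phi_sol S0 t Oz0 Sa).
exists z; last first.
  exists 0 => //; rewrite /z /two_sided lexx.
  have [_ P0 _ _] := semi_flow_Phi; apply: P0.
  by have /(recurrentP clK vK mono semi_flow_Phi Phi_sol S0)[] := Oz0.
split; last by move=> _ [t _ <-].
split=> [t|a Da t s].
  by have := ode z0 t Oz0; rewrite (Omega_interior vK _ Se d0 eK).
(* A saddle point a outside K: points of the segment [e, a] close to e are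
   saddle points in K. *)
have n0 : 0 < edist a e + 1 by rewrite ltr_wpDl ?edist_ge0.
pose c := Num.min 1 (d / (edist a e + 1)).
have c_gt0 : 0 < c by rewrite lt_min ltr01 divr_gt0.
have c1 : c <= 1 by rewrite ge_min lexx.
pose b := c *: a + (1 - c) *: e.
have Sb : equilibria K f b.
  apply: K_saddle; first exact: (saddle_points_convex phiD vDx vDy (ltW c_gt0) c1 Da De).
  apply: eK; rewrite (edist_barycenterr _ _ (ltW c_gt0) c1).
  have : c * (edist a e + 1) <= d by rewrite -ler_pdivlMr// ge_min lexx orbT.
  by move: c_gt0; lra.
(* Stewart's identity expresses the distance to [a] through the constant distances to [b] and [e],
   because the weight [c] is positive. *)
have h r := edist_barycenter_sqr c a e (z r).
have : c * edist (z t) a ^+ 2 = c * edist (z s) a ^+ 2.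
  have := h t; have := h s; rewrite -/b !(z_dist _ Sb) !(z_dist _ Se); lra.
move/(mulfI (lt0r_neq0 c_gt0))/eqP; rewrite eqrXn2 ?edist_ge0// => /eqP.
exact.
Qed.
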